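(* Let $(\vec u,\tilde p,\phi,\mu,\vec\psi)$ be a sufficiently smooth solution on $\omega\times(0,T)$ of the reference system $$ \left\{ \begin{array}{l} \rho\,\mathrm{Re}\big(\partial_t\vec u+(\vec u\cdot\nabla)\vec u\big)+\nabla\tilde p-\nabla\cdot(\eta(\phi)\nabla\vec u) =\mu\nabla\phi-\frac12\nu'(\phi)|\nabla\vec\psi|^2\nabla\phi+\nabla\cdot\big(\nu(\phi)(\nabla\vec\psi)^T\nabla\vec\psi\big)-\frac{\eta(\phi)}{\kappa(\phi)}(1-\phi)\vec u,\\[2pt] \nabla\cdot\vec u=0,\\[2pt] \partial_t\vec\psi+(\vec u\cdot\nabla)\vec\psi=\epsilon\,\nabla\cdot(\nu(\phi)\nabla\vec\psi),\\[2pt] \partial_t\phi+\vec u\cdot\nabla\phi=\tau\Delta\mu,\\[2pt] \mu=-\lambda\Delta\phi+\lambda\gamma f(\phi)+\frac12\nu'(\phi)|\nabla\vec\psi|^2, \end{array} \right. $$ and let $(\vec v,\tilde\pi,\varphi,\xi,\vec\zeta)$ be a sufficiently smooth solution on $\omega\times(0,T)$ of the nudged (assimilated) system $$ \left\{ \begin{array}{l} \rho\,\mathrm{Re}\big(\partial_t\vec v+(\vec v\cdot\nabla)\vec v\big)+\nabla\tilde\pi-\nabla\cdot(\eta(\varphi)\nabla\vec v) =\xi\nabla\varphi-\frac12\nu'(\varphi)|\nabla\vec\zeta|^2\nabla\varphi+\nabla\cdot\big(\nu(\varphi)(\nabla\vec\zeta)^T\nabla\vec\zeta\big)-\frac{\eta(\varphi)}{\kappa(\varphi)}(1-\varphi)\vec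 v+\alpha_u I_H(\vec u-\vec v),\\[2pt] \nabla\cdot\vec v=0,\\[2pt] \partial_t\vec\zeta+(\vec v\cdot\nabla)\vec\zeta=\epsilon\,\nabla\cdot(\nu(\varphi)\nabla\vec\zeta)+\alpha_\psi I_H(\vec\psi-\vec\zeta),\\[2pt] \partial_t\varphi+\vec v\cdot\nabla\varphi=\tau\Delta\xi+\alpha_\phi I_H(\phi-\varphi),\\[2pt] \xi=-\lambda\Delta\varphi+\lambda\gamma f(\varphi)+\frac12\nu'(\varphi)|\nabla\vec\zeta|^2, \end{array} \right. $$ where on $\partial\omega\times(0,T)$, with $\vec n$ the outward unit normal, $$ \vec u=\vec 0,\ \ \partial_{\vec n}\phi=\partial_{\vec n}\mu=0,\ \ \nu(\phi)\partial_{\vec n}\vec\psi=0,\qquad \vec v=\vec 0,\ \ \partial_{\vec n}\varphi=\partial_{\vec n}\xi=0,\ \ \nu(\varphi)\partial_{\vec n}\vec\zeta=0, $$ and the initial data are $(\vec u,\phi,\vec\psi)(\cdot,0)=(\vec u_0,\phi_0,\vec\psi_0)$ and $(\vec v,\varphi,\vec\zeta)(\cdot,0)=(\vec v_0,\varphi_0,\vec\zeta_0)$ (the latter may be chosen independently of the former). Assume that the linear observation operator $I_H$ satisfies $$ \|w-I_Hw\|_{L^2(\omega)}^2\le\frac14c_0^2h^4\|w\|_{H^2(\omega)}^2\qquad\forall\,w\in H^2(\omega). $$ Then: (1) The reference phase mass is conserved: $\displaystyle\int_\omega\phi(t)\,dx=\int_\omega\phi_0\,dx$ for all $t\in[0,T]$.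 (2) The assimilated phase mass satisfies $\displaystyle\frac{d}{dt}\int_\omega\varphi(t)\,dx=\alpha_\phi\int_\omega I_H(\phi-\varphi)\,dx$. (3) Let $e_\phi:=\phi-\varphi$. Then the mean error satisfies $$ \frac{d}{dt}\int_\omega e_\phi\,dx+\alpha_\phi\int_\omega e_\phi\,dx=\alpha_\phi\int_\omega(e_\phi-I_He_\phi)\,dx. $$ Consequently, with $\overline\phi:=|\omega|^{-1}\int_\omega\phi\,dx$ and $\overline\varphi:=|\omega|^{-1}\int_\omega\varphi\,dx$, $$ \left|\frac{d}{dt}\big(\overline\phi-\overline\varphi\big)+\alpha_\phi(\overline\phi-\overline\varphi)\right|\le\frac{c_0}{2}\,\alpha_\phi\,|\omega|^{-1/2}h^2\,\|e_\phi\|_{H^2(\omega)}. $$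
   Context: Here $\omega\subset\mathbb R^2$ is a bounded simply connected domain with $C^2$ boundary, $|\omega|$ its area, and $T>0$. The numbers $\rho,\mathrm{Re},\lambda,\gamma,\tau,\epsilon>0$ are fixed constants and $\alpha_u,\alpha_\phi,\alpha_\psi\ge0$ are the nudging parameters. The reference unknowns are velocity $\vec u$ ($\mathbb R^2$-valued), modified pressure $\tilde p$, phase $\phi$, chemical potential $\mu$ and auxiliary field $\vec\psi$ ($\mathbb R^2$-valued); $(\vec v,\tilde\pi,\varphi,\xi,\vec\zeta)$ are the corresponding assimilated unknowns. The coefficients $\eta,\nu,\kappa\in C^1(\mathbb R)$ have derivatives bounded on bounded sets and satisfy, for all admissible values $s$ of the phase, $0<\eta_{\min}\le\eta(s)\le\eta_{\max}$, $0\le\nu_{\min}\le\nu(s)\le\nu_{\max}$, $0<\kappa_{\min}\le\kappa(s)\le\kappa_{\max}$. The potential $F\in C^2(\mathbb R)$ is a double well with $f:=F'$, and there are $q\ge3$, $C,c_F>0$, $C_F\ge0$ with $|f(s)|\le C(1+|s|^{q-1})$ and $F(s)\ge c_F|s|^q-C_F$ for all $s\in\mathbb R$. $I_H$ is a linear interpolant mapping sufficiently regular fields on $\omega$ into an observation space (applied componentwise to vector fields); $h>0$ is the observational resolution and $c_0>0$ is a constant independent of $h$. Conventions: $(\nabla\vec a)_{kj}=\partial_ja_k$, so $\big((\nabla\vec\psi)^T\nabla\vec\psi\big)_{ij}=\sum_k\partial_i\psi_k\partial_j\psi_k$; the divergence of a matrix field is row-wise. ''Sufficiently smooth'' means all derivatives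 appearing, and the integrations by parts needed, make sense classically up to the boundary. *)

(* Defs.v *)
From HB Require Import structures.
From mathcomp Require Export all_boot all_order all_algebra.
From mathcomp Require Export all_classical all_reals all_analysis.
Export Order.TTheory GRing.Theory Num.Theory.
Export numFieldNormedType.Exports.

Set Implicit Arguments.
Unset Strict Implicit.
Unset Printing Implicit Defensive.

Global Open Scope classical_set_scope.
Global Open Scope ring_scope.

Section plane.
Context {R : realType}.
Implicit Types (omega : set (R * R)) (w : R * R -> R).

Definition leb2 := (@lebesgue_measure R \x @lebesgue_measure R)%E.

(* Integral and area over a subset of the plane; only used for bounded sets
   and integrable functions, where the extended-real values are finite. *)
Definition int2 omega w : R := \int[leb2]_(x in omega) w x.
Definition area omega : R := fine (leb2 omega).

Definition mean omega w : R := (area omega)^-1 * int2 omega w.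

Definition basis (i : 'I_2) : R * R := if i == ord0 then (1, 0) else (0, 1).

(* Classical partial derivative in the plane. *)
Definition partial (i : 'I_2) w (x : R * R) : R := 'D_(basis i) w x.

(* C^k on an open set U. *)
Fixpoint Ck_on (U : set (R * R)) (k : nat) w : Prop :=
  (forall x, U x -> {for x, continuous w}) /\
  match k with
  | 0 => True
  | k'.+1 => forall i, (forall x, U x -> derivable w x (basis i)) /\
                       Ck_on U k' (partial i w)
  end.

(* Every loop in A contracts, in A and with fixed base point, to a point. *)
Definition simply_connected (A : set (R * R)) : Prop :=
  forall g : R -> R * R,
    {within `[0, 1], continuous g} ->
    (forall s, 0 <= s <= 1 -> A (g s)) -> g 0 = g 1 ->
    exists H : R * R -> R * R,
      [/\ {within (`[0, 1] `*` `[0, 1])%classic, continuous H},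
          forall s r, 0 <= s <= 1 -> 0 <= r <= 1 -> A (H (s, r)),
          forall s, 0 <= s <= 1 -> H (s, 0) = g s /\ H (s, 1) = g 0 &
          forall r, 0 <= r <= 1 -> H (0, r) = g 0 /\ H (1, r) = g 0].

Definition bd omega : set (R * R) := closure omega `\` interior omega.

(* r is a C^2 defining function of omega in the neighbourhood U of x0. *)
Definition C2_chart omega (x0 : R * R) (U : set (R * R)) (r : R * R -> R) :=
  [/\ open U, U x0, Ck_on U 2 r, exists i, partial i r x0 != 0 &
      forall x, U x -> (omega x <-> r x < 0)].

Definition C2_boundary omega : Prop :=
  forall x0, bd omega x0 -> exists U r, C2_chart omega x0 U r.

(* n = grad r / |grad r| for a defining function r, negative inside omega. *)
Definition outward_normal omega (x : R * R) (n : 'I_2 -> R) : Prop :=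
  exists U r, C2_chart omega x U r /\
    forall i, n i = partial i r x / Num.sqrt (\sum_(j < 2) partial j r x ^+ 2).

Definition C2_simply_connected_domain omega : Prop :=
  [/\ open omega, omega !=set0, connected omega, bounded_set omega &
      simply_connected omega /\ C2_boundary omega].

Definition L2norm omega w : R :=
  fine (Lnorm leb2 2%:E (EFin \o (w \_ omega))).

Definition L2 omega w : Prop :=
  measurable_fun omega w /\
  (Lnorm leb2 2%:E (EFin \o (w \_ omega)) < +oo)%E.

(* C_c^oo(omega), extended by zero to the plane. *)
Definition test_function omega (chi : R * R -> R) : Prop :=
  (forall k, Ck_on setT k chi) /\
  exists K, [/\ compact K, K `<=` omega & forall x, ~ K x -> chi x = 0].

Definition weak_derivative omega (a b : nat) w (g : R * R -> R) : Prop :=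
  L2 omega g /\
  forall chi, test_function omega chi ->
    int2 omega (fun x => w x * iter a (partial ord0) (iter b (partial ord_max) chi) x)
    = (-1) ^+ (a + b) * int2 omega (fun x => g x * chi x).

Definition H2 omega w : Prop :=
  L2 omega w /\
  forall a b, (a + b <= 2)%N -> exists g, weak_derivative omega a b w g.

(* A representative of D^(a,b) w, which is unique up to a null set. *)
Definition Dweak omega (a b : nat) w : R * R -> R :=
  xget (cst 0) [set g | weak_derivative omega a b w g].

Definition H2norm omega w : R :=
  Num.sqrt (\sum_(a < 3) \sum_(b < 3 | (a + b <= 2)%N)
              L2norm omega (Dweak omega a b w) ^+ 2).

(* A linear operator from H^2(omega) to L^2(omega). Fields on omega are
   represented by functions on the plane, of which only the values in omega
   matter. *)
Definition observation_operator omega (IH : (R * R -> R) -> (R * R -> R)) :=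
  (forall w, H2 omega w -> L2 omega (IH w)) /\
  (forall (a : R) w1 w2, H2 omega w1 -> H2 omega w2 ->
     forall x, omega x ->
       IH (fun y => a * w1 y + w2 y) x = a * IH w1 x + IH w2 x).

End plane.

Section one_variable.
Context {R : realType}.
Implicit Types g F : R -> R.

Definition C1 g : Prop := (forall s, derivable g s 1) /\ continuous (derive1 g).

Definition C2 F : Prop := C1 F /\ C1 (derive1 F).

Definition bounded_on_bounded g : Prop :=
  forall M : R, exists K : R, forall s, `|s| <= M -> `|g s| <= K.

Definition coefficient g : Prop := C1 g /\ bounded_on_bounded (derive1 g).

(* Two wells (local minima a and b) separated by a barrier at c. *)
Definition double_well F : Prop :=
  exists a b c : R, [/\ a < c < b, F a < F c, F b < F c,
    \forall s \near a, F a <= F s & \forall s \near b, F b <= F s].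

End one_variable.

Section evolution.
Context {R : realType}.

(* A scalar field is a function of time and position; a vector field is given
   by its two components. *)
Definition field := R -> R * R -> R.

Context (omega : set (R * R)) (T : R).
Implicit Types w : field.

Definition dt w : field := fun t x => derive1 (w ^~ x) t.
Definition dx (i : 'I_2) w : field := fun t => partial i (w t).

Definition cylinder : set (R * (R * R)) := (`]0, T[ `*` omega)%classic.

(* Continuous on (0,T) x omega, up to the lateral boundary (0,T) x bd omega:
   the interior values have a limit at every point of (0,T) x closure omega. *)
Definition C0bar w : Prop :=
  forall t x, 0 < t < T -> closure omega x ->
    cvg (w z.1 z.2 @[z --> within cylinder (nbhs (t, x))]).

(* The continuous extension to (0,T) x closure omega. *)
Definition trace w : field :=
  fun t x => lim (w z.1 z.2 @[z --> within cylinder (nbhs (t, x))]).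

Definition C1t w : Prop :=
  (forall t x, 0 < t < T -> omega x -> derivable (w ^~ x) t 1) /\ C0bar (dt w).

(* All spatial derivatives up to order k exist in the cylinder and are
   continuous up to the lateral boundary. *)
Fixpoint Ckx (k : nat) w : Prop :=
  C0bar w /\
  match k with
  | 0 => True
  | k'.+1 => forall i,
      (forall t x, 0 < t < T -> omega x -> derivable (w t) x (basis i)) /\
      Ckx k' (dx i w)
  end.

Definition continuous_closed w : Prop :=
  {within (`[0, T] `*` closure omega)%classic, continuous (fun z : R * (R * R) => w z.1 z.2)}.

(* Normal derivative on the lateral boundary, the gradient being extended
   continuously from the interior. *)
Definition dn (n : 'I_2 -> R) w : field :=
  fun t x => \sum_(i < 2) n i * trace (dx i w) t x.

Record state := MkState {
  vel : 'I_2 -> field;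
  pres : field;
  phase : field;
  chem : field;
  aux : 'I_2 -> field }.

Record parameters := MkParameters {
  rho : R; Rey : R; lam : R; gam : R; tau : R; eps : R;
  eta : R -> R; nu : R -> R; kap : R -> R;
  pot : R -> R }.

Definition regular (S : state) : Prop :=
  [/\ forall i, [/\ continuous_closed (vel S i), C1t (vel S i) & Ckx 2 (vel S i)],
      Ckx 1 (pres S),
      [/\ continuous_closed (phase S), C1t (phase S) & Ckx 2 (phase S)],
      Ckx 2 (chem S) &
      forall i, [/\ continuous_closed (aux S i), C1t (aux S i) & Ckx 2 (aux S i)]].

Definition laplacian w : field := fun t x => \sum_(j < 2) dx j (dx j w) t x.

Definition divergence (W : 'I_2 -> field) : field :=
  fun t x => \sum_(j < 2) dx j (W j) t x.

(* (a . grad) w *)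
Definition advect (a : 'I_2 -> field) w : field :=
  fun t x => \sum_(j < 2) a j t x * dx j w t x.

Definition grad_sq (W : 'I_2 -> field) : field :=
  fun t x => \sum_(k < 2) \sum_(j < 2) dx j (W k) t x ^+ 2.

(* The system of equations in (0,T) x omega, with additional source terms
   gu, gpsi and gphi in the evolution equations of velocity, auxiliary field
   and phase. *)
Definition solves (P : parameters) (S : state)
    (gu gpsi : 'I_2 -> field) (gphi : field) : Prop :=
  let u := vel S in let p := pres S in let phi := phase S in
  let mu := chem S in let psi := aux S in
  forall t x, 0 < t < T -> omega x ->
  [/\ forall i,
        rho P * Rey P * (dt (u i) t x + advect u (u i) t x) + dx i p t x
        - divergence (fun j s y => eta P (phi s y) * dx j (u i) s y) t x
        = mu t x * dx i phi t x
          - 2^-1 * derive1 (nu P) (phi t x) * grad_sq psi t x * dx i phi t x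
          + divergence (fun j s y => nu P (phi s y) *
              \sum_(k < 2) dx i (psi k) s y * dx j (psi k) s y) t x
          - eta P (phi t x) / kap P (phi t x) * (1 - phi t x) * u i t x
          + gu i t x,
      divergence u t x = 0,
      forall i,
        dt (psi i) t x + advect u (psi i) t x
        = eps P * divergence (fun j s y => nu P (phi s y) * dx j (psi i) s y) t x
          + gpsi i t x,
      dt phi t x + advect u phi t x = tau P * laplacian mu t x + gphi t x &
      mu t x = - lam P * laplacian phi t x + lam P * gam P * derive1 (pot P) (phi t x)
               + 2^-1 * derive1 (nu P) (phi t x) * grad_sq psi t x].

Definition boundary_conditions (P : parameters) (S : state) : Prop :=
  forall t x n, 0 < t < T -> bd omega x -> outward_normal omega x n ->
  [/\ forall i, vel S i t x = 0,
      dn n (phase S) t x = 0,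
      dn n (chem S) t x = 0 &
      forall i, nu P (phase S t x) * dn n (aux S i) t x = 0].

Definition initial_conditions (S : state)
    (u0 : 'I_2 -> R * R -> R) (phi0 : R * R -> R) (psi0 : 'I_2 -> R * R -> R) :=
  forall x, omega x ->
  [/\ forall i, vel S i 0 x = u0 i x, phase S 0 x = phi0 x &
      forall i, aux S i 0 x = psi0 i x].

Definition reference_solution (P : parameters) (S : state) u0 phi0 psi0 : Prop :=
  [/\ regular S, solves P S (fun _ _ _ => 0) (fun _ _ _ => 0) (fun _ _ => 0),
      boundary_conditions P S & initial_conditions S u0 phi0 psi0].

(* IH acts on space only, and componentwise on vector fields. *)
Definition nudging (alpha : R) (IH : (R * R -> R) -> (R * R -> R))
    (w1 w2 : field) : field :=
  fun t x => alpha * IH (fun y => w1 t y - w2 t y) x.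

Definition assimilated_solution (P : parameters) (alpha_u alpha_phi alpha_psi : R)
    (IH : (R * R -> R) -> (R * R -> R)) (S A : state) v0 vphi0 zeta0 : Prop :=
  [/\ regular A,
      solves P A (fun i => nudging alpha_u IH (vel S i) (vel A i))
                 (fun i => nudging alpha_psi IH (aux S i) (aux A i))
                 (nudging alpha_phi IH (phase S) (phase A)),
      boundary_conditions P A & initial_conditions A v0 vphi0 zeta0].

End evolution.

(* Main.v *)
Require Import Defs.
From mathcomp Require Import ring lra measurable_realfun.

Set Implicit Arguments.
Unset Strict Implicit.
Unset Printing Implicit Defensive.

(** The phase equation is a conservation law: since the velocity is solenoidal,
    it reads dphi/dt = - div W + g with W = phi u - tau grad mu, where the source
    g vanishes for the reference solution and is alpha_phi IH(phi - vphi) for the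
    assimilated one. On the boundary u = 0 and the normal derivative of mu
    vanishes, so W has no normal component there, and Gauss' theorem makes the
    integral of div W vanish. Hence the mass changes at the rate given by the
    integral of g ([mass_balance]). For the reference solution the mass thus has
    derivative zero on (0,T) and is continuous on [0,T], hence is constant.
    Subtracting the two balances and adding alpha_phi times the integral of the
    error gives the equation of the mean error, and the final bound
    is the Cauchy-Schwarz inequality [norm_int2_L2] combined with the
    interpolation estimate; the latter applies because the classical
    derivatives of the error are weak derivatives ([weak_derivatives]).

    The substantial ingredient is Gauss' theorem on a C^2 domain for fields
    without normal component ([divergence_tangential]). Vanishing of the normal
    component permits a proof that neither flattens the boundary nor introduces a
    boundary integral. For a field with compact support in omega, Fubini's theorem
    and the fundamental theorem of calculus on lines suffice
    ([int2_partial_compact_support]). Near a boundary point, let r be a defining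
    function and multiply W by a cutoff chi_e that vanishes for -e < r < 0 and is
    1 for r < -2e. The product has compact support, so the integral of div W
    equals that of (1 - chi_e) div W - grad chi_e . W, which lives on the strip
    -2e < r < 0. There div W is bounded, grad chi_e is of size 1/e, and W . grad r
    tends to 0 uniformly ([flux_small]), so the integrand is O(1) + o(1/e); the
    strip has area O(e), because r has slope bounded away from 0 along the lines
    of one coordinate direction ([strip_section], [leb2_le_sections]). Letting e
    tend to 0 gives the claim for fields supported near one boundary point
    ([boundary_local]), and compactness of the closure of omega reduces the
    general case to finitely many such fields ([divergence_cover]). *)

(** * Sets and integrable functions in the plane *)

Section plane_integrals.
Context {R : realType}.
Implicit Types (omega U : set (R * R)) (w : R * R -> R).

(** Every open set is the union of the countably many balls with rational
    centre and radius that it contains. *)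
Lemma open_measurable2 U : open U -> measurable U.
Proof.
move=> oU.
rewrite (_ : U = \bigcup_(q : rat * rat * rat)
  (if `[< ball (ratr q.1.1 : R, ratr q.1.2 : R) (ratr q.2) `<=` U >] then
   ball (ratr q.1.1 : R, ratr q.1.2 : R) (ratr q.2 : R) else set0)).
  apply: countable_bigcupT_measurable => // q.
  case: ifPn => // _.
  have -> : ball (ratr q.1.1 : R, ratr q.1.2 : R) (ratr q.2 : R) =
     ball (ratr q.1.1 : R) (ratr q.2 : R) `*` ball (ratr q.1.2 : R) (ratr q.2 : R).
    by apply/seteqP; split => -[x y] [].
  by apply: measurableX; rewrite ball_itv; exact: measurable_itv.
apply/seteqP; split => [[x1 x2] Ux|x [q _]]; last first.
  by case: ifPn => // /asboolP; apply.
have /nbhs_ballP[e /= e0 eU] : nbhs (x1, x2) U by exact: open_nbhs_nbhs.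
have [r /andP[r0 re]] : exists r : rat, (0 < (ratr r : R) < e / 2)%R.
  have e2 : 0 < e / 2 by lra.
  have [r] := rat_in_itvoo e2.
  by rewrite in_itv /=; exists r.
have P (x : R) : exists p : rat, ball (ratr p : R) (ratr r : R) x.
  have [p] := @rat_in_itvoo R (x - ratr r) (x + ratr r) ltac:(lra).
  rewrite in_itv /= => /andP[a b]; exists p.
  by rewrite /ball /= ltr_distl; apply/andP; split; lra.
have [p1 P1] := P x1; have [p2 P2] := P x2.
exists (p1, p2, r) => //=.
case: ifPn => [_|/asboolPn]; first by split.
case=> -[y1 y2] [/= B1 B2]; apply: eU.
(* a ball of radius r < e / 2 around p that contains x lies in the ball of
   radius e around x *)
have T (p : rat) (x y : R) : ball (ratr p : R) (ratr r : R) x ->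
   ball (ratr p : R) (ratr r : R) y -> ball x e y.
   move=> A B; apply: (@le_ball _ _ _ (ratr r + ratr r)); first lra.
   by apply: ball_triangle B; exact: ball_sym.
by split; [exact: T P1 B1|exact: T P2 B2].
Qed.

Definition bounded_on omega w := exists M, forall x, omega x -> `|w x| <= M.

Definition continuous_on omega w := forall x, omega x -> {for x, continuous w}.

Lemma bounded_onP omega w : bounded_on omega w -> [bounded w x | x in omega].
Proof.
move=> [M wM]; exists M; split; first exact: num_real.
by move=> M' /ltW MM' x /wM /le_trans; apply.
Qed.

Lemma bounded_on_ge0 omega w : bounded_on omega w ->
  exists2 M, 0 <= M & forall x, omega x -> `|w x| <= M.
Proof.
move=> [M wM]; exists `|M| => // x /wM /le_trans; apply; exact: ler_norm.
Qed.

(** The closed ball of the maximum norm, as a product of segments: compactness,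
    measurability and area are then those of intervals. *)
Definition box (x : R * R) (d : R) : set (R * R) :=
  (`[x.1 - d, x.1 + d] `*` `[x.2 - d, x.2 + d])%classic.

Lemma boxE x d y : box x d y <-> `|x.1 - y.1| <= d /\ `|x.2 - y.2| <= d.
Proof.
rewrite /box /= !in_itv /= !ler_distl.
by split => -[/andP[? ?] /andP[? ?]]; split; apply/andP; split; lra.
Qed.

Lemma compact_box x d : compact (box x d).
Proof. by apply: compact_setX; exact: segment_compact. Qed.

Lemma closed_box x d : closed (box x d).
Proof.
apply: compact_closed; last exact: compact_box.
exact: norm_hausdorff.
Qed.

Lemma nbhs_boxP (x : R * R) U :
  nbhs x U <-> exists2 d, 0 < d & box x d `<=` U.
Proof.
split=> [/nbhs_ballP[e /= e0 eU]|[d d0 dU]].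
  exists (e / 2); first lra.
  move=> y /boxE[h1 h2]; apply: eU; split => /=; rewrite /ball /=; lra.
apply/nbhs_ballP; exists d => //= y [h1 h2]; apply: dU; apply/boxE.
by split; apply: ltW.
Qed.

Lemma bounded_sub_box omega : bounded_set omega ->
  exists2 d, 0 < d & omega `<=` box (0, 0) d.
Proof.
move=> [M [_ /(_ (`|M| + 1))]] Mb.
exists (`|M| + 1) => [|x /Mb].
  by have := normr_ge0 M; lra.
have MM : M < `|M| + 1 by have := ler_norm M; lra.
move=> /(_ MM) /=; rewrite prod_normE ge_max => /andP[x1 x2].
by apply/boxE; split; rewrite /= sub0r normrN.
Qed.

Lemma compact_closure_bounded omega :
  bounded_set omega -> compact (closure omega).
Proof.
move=> /bounded_sub_box[d _ od].
apply: (@subclosed_compact _ _ (box (0, 0) d)).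
- exact: closed_closure.
- exact: compact_box.
- by rewrite [X in _ `<=` X](closure_id _).1//; [exact: closure_subset|exact: closed_box].
Qed.

Lemma measurable_box x d : measurable (box x d).
Proof. by apply: measurableX; exact: measurable_itv. Qed.

Lemma leb2_box x d : 0 <= d -> leb2 (box x d) = ((2 * d) * (2 * d))%:E.
Proof.
move=> d0; rewrite /leb2 product_measure1E; [|exact: measurable_itv..].
have mI (a : R) : lebesgue_measure `[a - d, a + d]%classic = (2 * d)%:E.
  rewrite lebesgue_measure_itv /= lte_fin.
  have [|] := ltP (a - d) (a + d); rewrite -?EFinD => h; congr EFin; lra.
have -> : ((2 * d) * (2 * d))%:E = ((2 * d)%:E * (2 * d)%:E)%E :> \bar R by [].
by congr (_ * _)%E; exact: mI.
Qed.
Lemma leb2_bounded omega : measurable omega -> bounded_set omega ->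
  (leb2 omega < +oo)%E.
Proof.
move=> mo /bounded_sub_box[d /ltW d0 od].
apply: (@le_lt_trans _ _ (leb2 (box (0, 0) d))).
  by apply: le_measure => //; rewrite inE//; exact: measurable_box.
by rewrite leb2_box// ltry.
Qed.

Lemma continuous_on_measurable omega w : open omega ->
  continuous_on omega w -> measurable_fun omega w.
Proof.
move=> oo cw; apply: (measurability _ (RGenOpens.measurableE R)).
move=> _ [_ [a [b ->] <-]]; apply: open_measurable2.
rewrite openE => x [ox wx]; apply: filterI; first exact: open_nbhs_nbhs.
by apply: (cw x ox); apply: open_nbhs_nbhs; split => //; exact: interval_open.
Qed.

Section bounded_open.
Context (omega : set (R * R)) (oo : open omega) (bo : bounded_set omega).

Let mo : measurable omega := open_measurable2 oo.

Lemma continuous_on_integrable w : continuous_on omega w -> bounded_on omega w ->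
  leb2.-integrable omega (EFin \o w).
Proof.
move=> cw bw; apply: measurable_bounded_integrable => //.
- exact: leb2_bounded.
- exact: continuous_on_measurable.
- exact: bounded_onP.
Qed.

(** Local boundedness up to the boundary is enough, because the closure is compact;
    the covering argument is run along the filter of large bounds. *)
Lemma bounded_on_closure w :
  (forall z, closure omega z ->
     exists M : R, \forall x \near z, omega x -> `|w x| <= M) ->
  bounded_on omega w.
Proof.
move=> locb.
have /compact_near_coveringP := compact_closure_bounded bo.
move=> /(_ R +oo%R (fun M x => omega x -> `|w x| <= M) _) cov.
have [z /locb[M nM]|M0 [_ HM]] := cov _.
  near=> x M' => /= ox; apply: (@le_trans _ _ M); last by near: M'; apply: nbhs_pinfty_ge; exact: num_real.
    by move: ox; near: x.
exists (M0 + 1) => x ox; apply: (HM (M0 + 1)) => //; first lra.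
exact: subset_closure.
Unshelve. all: by end_near. Qed.

End bounded_open.

Lemma norm_int2_le omega w (M : R) : measurable omega ->
  (leb2 omega < +oo)%E -> leb2.-integrable omega (EFin \o w) ->
  (forall x, omega x -> `|w x| <= M) -> `|int2 omega w| <= M * area omega.
Proof.
move=> mo fo iw wM; apply: le_trans (le_normr_Rintegral _ _) _ => //.
rewrite /area -Rintegral_cst //; apply: le_Rintegral => //.
  by have := integrable_norm iw.
apply: measurable_bounded_integrable => //.
by apply/bounded_onP; exists `|M|.
Qed.

Lemma eq_int2 omega w1 w2 : (forall x, omega x -> w1 x = w2 x) ->
  int2 omega w1 = int2 omega w2.
Proof. by move=> e; apply: eq_Rintegral => x; rewrite inE => /e. Qed.

End plane_integrals.

(** * Compactly supported functions have derivatives of integral zero *)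

Section compact_support.
Context {R : realType}.
Implicit Types (omega U K : set (R * R)) (w f : R * R -> R) (i : 'I_2).

(** The point of abscissa [s] on the line of direction [basis i] whose other
    coordinate is [b]; partial derivatives and iterated integrals in either
    direction become statements about [line i]. *)
Definition line i (b s : R) : R * R := if i == ord0 then (s, b) else (b, s).

Lemma shift_line i b s h : h *: @basis R i + line i b s = line i b (h + s).
Proof.
by rewrite /line /basis; case: ifP => _;
  congr pair; rewrite /= ?scaler0 ?add0r // [h *: 1]mulr1.
Qed.

Let quotient_line i w b s :
  (fun h : R => h^-1 *: (((w \o line i b) \o shift s) (h *: 1) - (w \o line i b) s)) =
  (fun h => h^-1 *: ((w \o shift (line i b s)) (h *: basis i) - w (line i b s))).
Proof. by apply/funext => h /=; rewrite shift_line [h *: 1]mulr1. Qed.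

Lemma derive_line i w b s : 'D_1 (w \o line i b) s = partial i w (line i b s).
Proof. by rewrite /partial /derive quotient_line. Qed.

Lemma derivable_line i w b s :
  derivable (w \o line i b) s 1 = derivable w (line i b s) (basis i).
Proof. by rewrite /derivable (quotient_line i w b s). Qed.

Lemma continuous_line i b : continuous (line i b).
Proof.
move=> s; rewrite /line; case: (i == ord0) => /=.
  by apply: (@cvg_pair _ _ _ (nbhs s) (nbhs s) (nbhs b)); [exact: cvg_id|exact: cvg_cst].
by apply: (@cvg_pair _ _ _ (nbhs s) (nbhs b) (nbhs s)); [exact: cvg_cst|exact: cvg_id].
Qed.

Lemma lineP i x : exists b s, x = line i b s.
Proof.
by case: x => x y; rewrite /line; case: (i == ord0); [exists y, x|exists x, y].
Qed.

Lemma fubini_line i f : leb2.-integrable setT (EFin \o f) ->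
  (\int[leb2]_x (f x)%:E =
   \int[lebesgue_measure]_b \int[lebesgue_measure]_s (f (line i b s))%:E)%E.
Proof.
move=> fi; rewrite /line; case: (i == ord0).
  by rewrite -(integral21_prod_meas1 fi).
by rewrite -(integral12_prod_meas1 fi).
Qed.

Lemma near_partial i w w' (x : R * R) : (\forall y \near x, w y = w' y) ->
  \forall y \near x, partial i w y = partial i w' y.
Proof.
move=> /near_join; apply: filterS => y ww'.
exact: near_eq_derive.
Qed.

Lemma partial_cst i (c : R) x : partial i (cst c) x = 0.
Proof. by rewrite /partial derive_cst. Qed.

Lemma compact_sub_box K : compact K ->
  exists2 d, 0 < d & K `<=` box (0, 0) d.
Proof. by move=> /compact_bounded /bounded_sub_box. Qed.

(** Extended by zero, [w] is differentiable in direction [i] on the whole plane,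
    with a continuous derivative: near a point outside [K] it vanishes. Along each
    line that derivative integrates to the difference of two zero values of [w]. *)
Lemma int2_partial_compact_support omega K w i : open omega -> compact K ->
  K `<=` omega -> (forall x, omega x -> derivable w x (basis i)) ->
  continuous_on omega (partial i w) ->
  (forall x, omega x -> ~ K x -> w x = 0) ->
  leb2.-integrable omega (EFin \o partial i w) /\ int2 omega (partial i w) = 0.
Proof.
move=> oo cK Ko dw cw w0.
have oK : open (~` K).
  by apply: closed_openC; apply: compact_closed => //; exact: norm_hausdorff.
pose W := w \_ omega.
have W_in x : omega x -> \forall y \near x, w y = W y.
  move=> ox; have : \forall y \near x, omega y by exact: open_nbhs_nbhs.
  by apply: filterS => y oy; rewrite /W patchE mem_set.
have W_out x : ~ K x -> \forall y \near x, cst 0 y = W y.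
  move=> Kx; have : \forall y \near x, ~ K y by exact: open_nbhs_nbhs.
  apply: filterS => y Ky; rewrite /W patchE.
  by case: ifPn => //; rewrite inE => oy; rewrite w0.
have dW x : derivable W x (basis i).
  have [ox|ox] := pselect (omega x).
    by apply: near_eq_derivable (W_in _ ox) _; exact: dw.
  apply: near_eq_derivable (W_out _ _) _ => [Kx|]; last exact: derivable_cst.
  by apply: ox; exact: Ko.
have W0 x : ~ K x -> W x = 0 by move=> /W_out /nbhs_singleton.
have pW0 x : ~ K x -> partial i W x = 0.
  by move=> /W_out /near_partial /nbhs_singleton => /(_ i) <-; exact: partial_cst.
have pWE x : (partial i w \_ omega) x = partial i W x.
  rewrite patchE; case: ifPn => [|/negP]; rewrite inE => ox.
    by have /near_partial/nbhs_singleton := W_in _ ox; apply.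
  by rewrite pW0// => Kx; apply: ox; exact: Ko.
have cW : continuous (partial i W).
  move=> x; have [ox|ox] := pselect (omega x).
    have pn := near_partial i (W_in _ ox).
    rewrite /continuous_at -(nbhs_singleton pn).
    by apply: cvg_trans (cw x ox); exact: near_eq_cvg.
  have Kx : ~ K x by move=> Kx; apply: ox; exact: Ko.
  rewrite /continuous_at (pW0 _ Kx).
  have pn := near_partial i (W_out _ Kx).
  apply: cvg_trans (cvg_cst _ : (0 : R) @[_ --> x] --> (0 : R)); apply: near_eq_cvg.
  by move: pn; apply: filterS => y <-; rewrite partial_cst.
have [d d0 Kd] := compact_sub_box cK.
have int_pW : leb2.-integrable setT (EFin \o partial i W).
  have -> : EFin \o partial i W = (EFin \o partial i W) \_ (box (0, 0) d).
    apply/funext => x; rewrite patchE; case: ifPn => // /negP; rewrite inE => bx.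
    by rewrite /= pW0// => /Kd.
  apply/integrable_restrict => //; first exact: measurable_box.
  rewrite setTI; apply: measurable_bounded_integrable.
  - exact: measurable_box.
  - by apply: leb2_bounded; [exact: measurable_box|exact/compact_bounded/compact_box].
  - apply: measurable_funS (continuous_on_measurable openT _) => //.
    by move=> x _; exact: cW.
  - apply/bounded_onP/bounded_on_closure; first exact/compact_bounded/compact_box.
    move=> z _; exists (`|partial i W z| + 1).
    have /cvgr_norm_le := cW z; move=> /(_ (`|partial i W z| + 1)) /=.
    rewrite ltrDl ltr01 => /(_ isT); apply: filterS => y + _; exact.
split.
  rewrite -[omega]setTI; apply/integrable_restrict => //.
    exact: open_measurable2.
  by move: int_pW; congr integrable; apply/funext => x /=; rewrite -pWE !patchE; case: ifP.
transitivity (\int[leb2]_x partial i W x).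
  by rewrite /int2 Rintegral_mkcond; apply: eq_Rintegral => x _; exact: pWE.
rewrite /Rintegral (fubini_line i int_pW).
rewrite integral0_eq// => b _.
have Wd s : d < `|s| -> ~ K (line i b s).
  move=> ds /Kd /boxE; rewrite /= !sub0r !normrN /line.
  by case: (i == ord0) => -[/=]; lra.
(* strictly beyond d, so that the endpoints lie outside the box containing K *)
pose D : R := d + 1.
rewrite (_ : (\int[lebesgue_measure]_s (partial i W (line i b s))%:E)%E =
   (\int[lebesgue_measure]_(s in `[(- D)%R, D]) (partial i W (line i b s))%:E)%E); last first.
  rewrite [in RHS]integral_mkcond; apply: eq_integral => s _.
  rewrite patchE; case: ifPn => // /negP; rewrite inE /= in_itv /= => H.
  rewrite pW0//; apply: Wd.
  rewrite ltNge; apply/negP; rewrite ler_norml => /andP[h1 h2]; apply: H.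
  by rewrite /D; apply/andP; split; lra.
rewrite (@continuous_FTC2 _ _ (W \o line i b)).
- have WD : W (line i b D) = 0 by apply/W0/Wd; rewrite ger0_norm /D; lra.
  have WND : W (line i b (- D)) = 0.
    by apply/W0/Wd; rewrite normrN ger0_norm /D; lra.
  by rewrite /= WD WND subee.
- by rewrite /D; lra.
- apply: continuous_subspaceT => s.
  by apply: continuous_comp; [exact: continuous_line|exact: cW].
- have dWl s : derivable (W \o line i b) s 1 by rewrite derivable_line; exact: dW.
  have cWl s : {for s, continuous (W \o line i b)}.
    by apply/differentiable_continuous/derivable1_diffP; exact: dWl.
  split => [s _| |]; first exact: dWl.
  - exact/cvg_at_right_filter/cWl.
  - exact/cvg_at_left_filter/cWl.
- by move=> s _; rewrite derive1E derive_line.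
Qed.

End compact_support.

(** * A plateau function *)

Section cutoff.
Context {R : realType}.
Implicit Types (U : set (R * R)) (w f : R * R -> R) (i j : 'I_2).

Lemma is_derive_line i w (b s d : R) :
  is_derive s 1 (w \o line i b) d <-> is_derive (line i b s) (basis i) w d.
Proof.
split=> -[dw <-]; split.
- by rewrite -derivable_line.
- by rewrite derive_line.
- by rewrite derivable_line.
- exact: derive_line.
Qed.

Lemma is_derive_comp (g : R -> R) i w x (dg dw : R) :
  is_derive (w x) 1 g dg -> is_derive x (basis i) w dw ->
  is_derive x (basis i) (g \o w) (dg * dw).
Proof.
have [b [s ->]] := lineP i x => hg /is_derive_line hw; apply/is_derive_line.
by rewrite -compA; apply: is_derive1_comp.
Qed.

Definition pos (s : R) : R := Num.max 0 s.

Lemma pos_le0 s : s <= 0 -> pos s = 0. Proof. by move=> ?; rewrite /pos max_l. Qed.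

Lemma pos_ge0 s : 0 <= s -> pos s = s. Proof. by move=> ?; rewrite /pos max_r. Qed.

Lemma continuous_pos : continuous pos.
Proof.
by move=> s; apply: continuous_max; [exact: cvg_cst|exact: cvg_id].
Qed.

(** The simplest C^1 function that vanishes exactly where [s <= 0]. *)
Definition sqpos (s : R) : R := pos s ^+ 2.

Lemma is_derive_sqpos (s : R) : is_derive s 1 sqpos (2 * pos s).
Proof.
have [s0|s0|->] := ltgtP s 0.
- have n : \forall t \near s, cst 0 t = sqpos t.
    near=> t; rewrite /sqpos pos_le0 ?expr0n//.
    by apply/ltW; near: t; exact: lt_nbhsl.
  apply: near_eq_is_derive n _; rewrite pos_le0 ?mulr0 ?ltW//.
  exact: is_derive_cst.
- have n : \forall t \near s, (id ^+ 2 : R -> R) t = sqpos t.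
    near=> t; rewrite /sqpos pos_ge0//.
    by apply/ltW; near: t; exact: lt_nbhsr.
  apply: near_eq_is_derive n _; rewrite pos_ge0 ?ltW//.
  apply: is_derive_eq; rewrite /= scaler1.
  by rewrite /GRing.scale /=; ring.
- apply/is_derive1_caratheodory; exists pos; split.
  + move=> z; rewrite /sqpos (pos_le0 (lexx 0)) expr0n !subr0.
    have [z0|/ltW z0] := leP 0 z; first by rewrite pos_ge0.
    by rewrite pos_le0// expr0n mul0r.
  + exact: continuous_pos.
  + by rewrite pos_le0// mulr0.
Unshelve. all: by end_near. Qed.

Lemma sqpos_ge0 s : 0 <= sqpos s.
Proof. exact: sqr_ge0. Qed.

Lemma sqpos_le0 s : s <= 0 -> sqpos s = 0.
Proof. by move=> s0; rewrite /sqpos pos_le0 // expr0n. Qed.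

Lemma sqposE s : 0 <= s -> sqpos s = s ^+ 2.
Proof. by move=> s0; rewrite /sqpos pos_ge0. Qed.

(** The square makes both transitions C^1: the inner [sqpos] leaves 0 where
    [s ^+ 2] passes 1, and the outer one reaches 0 where the inner one passes 1. *)
Definition plateau (s : R) : R := sqpos (1 - sqpos (s ^+ 2 - 1)).

Definition dplateau (s : R) : R :=
  2 * pos (1 - sqpos (s ^+ 2 - 1)) * - (2 * pos (s ^+ 2 - 1) * (2 * s)).

Lemma is_derive_plateau (s : R) : is_derive s 1 plateau (dplateau s).
Proof.
have h1 : is_derive s 1 (fun t : R => t ^+ 2 - 1 : R) (2 * s).
  have -> : (fun t : R => t ^+ 2 - 1 : R) = (id ^+ 2 : R -> R) - cst 1 by [].
  apply: is_derive_eq; rewrite subr0 /= scaler1.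
  by rewrite /GRing.scale /=; ring.
have h2 := @is_derive1_comp R sqpos (fun t => t ^+ 2 - 1) s _ _ (is_derive_sqpos _) h1.
have h3 : is_derive s 1 (fun t : R => 1 - sqpos (t ^+ 2 - 1) : R)
            (- (2 * pos (s ^+ 2 - 1) * (2 * s))).
  have -> : (fun t : R => 1 - sqpos (t ^+ 2 - 1) : R) =
            cst 1 - (sqpos \o (fun t : R => t ^+ 2 - 1)) by [].
  by apply: is_derive_eq; rewrite sub0r.
exact: (@is_derive1_comp R sqpos (fun t => 1 - sqpos (t ^+ 2 - 1)) s _ _ (is_derive_sqpos _) h3).
Qed.

Lemma plateau_ge0 s : 0 <= plateau s.
Proof. exact: sqpos_ge0. Qed.

Lemma plateau_le1 s : plateau s <= 1.
Proof.
rewrite /plateau; have := sqpos_ge0 (s ^+ 2 - 1).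
set q := sqpos _ => q0; have [q1|q1] := leP 0 (1 - q).
  by rewrite sqposE//; nra.
by rewrite sqpos_le0 ?ltW.
Qed.

Lemma plateau1 s : `|s| <= 1 -> plateau s = 1.
Proof.
rewrite ler_norml => /andP[s1 s2].
by rewrite /plateau (@sqpos_le0 (s ^+ 2 - 1)) ?subr0 ?sqposE ?expr1n//; nra.
Qed.

Lemma plateau0 s : 2 <= `|s| -> plateau s = 0.
Proof.
move=> s2; have s4 : 4 <= s ^+ 2 by rewrite -real_normK ?num_real//; nra.
by rewrite /plateau [X in 1 - X]sqposE ?sqpos_le0//; nra.
Qed.

Lemma dplateau_le s : `|dplateau s| <= 16.
Proof.
rewrite /dplateau; set q := sqpos _.
have [q1|q1] := leP (1 - q) 0.
  by rewrite (pos_le0 q1) mulr0 mul0r normr0.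
have pos0 t : 0 <= pos t by rewrite /pos le_max lexx.
have m0 := pos0 (s ^+ 2 - 1); have qE : q = pos (s ^+ 2 - 1) ^+ 2 by [].
have sm : s ^+ 2 - 1 <= pos (s ^+ 2 - 1) by rewrite /pos le_max lexx orbT.
set m := pos (s ^+ 2 - 1) in m0 sm qE *.
have m1 : m < 1 by nra.
have s2 : `|s| <= 2.
  by rewrite -(@ler_pXn2r _ 2) ?nnegrE// real_normK ?num_real//; nra.
clearbody q; rewrite (pos_ge0 (ltW q1)) mulrN normrN !normrM.
rewrite (ger0_norm m0) !(@ger0_norm _ 2)// (ger0_norm (ltW q1)).
have q0 : 1 - q <= 1 by nra.
have -> : 16 = 2 * 1 * (2 * 1 * (2 * 2)) :> R by ring.
by do ?apply: ler_pM => //; do ?apply: mulr_ge0 => //; exact: ltW.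
Qed.

Lemma dplateau0 s : 2 <= `|s| -> dplateau s = 0.
Proof.
move=> s2; have s4 : 4 <= s ^+ 2 by rewrite -real_normK ?num_real//; nra.
by rewrite /dplateau [X in 1 - X]sqposE ?[X in _ * X * _]pos_le0 ?mulr0 ?mul0r//; nra.
Qed.

Lemma continuous_dplateau : continuous dplateau.
Proof.
move=> s.
have c1 : {for s, continuous (fun t : R => t ^+ 2 - 1 : R)}.
  by apply: cvgB; [exact: exprn_continuous|exact: cvg_cst].
have c2 : {for s, continuous (fun t : R => pos (t ^+ 2 - 1))}.
  by apply: continuous_comp c1 _; exact: continuous_pos.
apply: cvgM.
  apply: cvgM; first exact: cvg_cst.
  apply: (@continuous_comp _ _ _ (fun t : R => 1 - sqpos (t ^+ 2 - 1))).
    by apply: cvgB; [exact: cvg_cst|apply: cvgM; exact: c2].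
  exact: continuous_pos.
apply: cvgN; apply: cvgM; apply: cvgM; [exact: cvg_cst|exact: c2|exact: cvg_cst|exact: cvg_id].
Qed.

End cutoff.

(** * C^1 functions of two variables *)

Section C1_calculus.
Context {R : realType}.
Implicit Types (U : set (R * R)) (w f g : R * R -> R) (i j : 'I_2).

Lemma Ck1_continuous U w : Ck_on U 1 w -> continuous_on U w.
Proof. by case. Qed.

Lemma Ck1_derivable U w i x : Ck_on U 1 w -> U x -> derivable w x (basis i).
Proof. by case=> _ /(_ i)[+ _] => /[apply]. Qed.

Lemma Ck1_partial U w i : Ck_on U 1 w -> continuous_on U (partial i w).
Proof. by case=> _ /(_ i)[_ []]. Qed.

Lemma Ck1_sub U V w : U `<=` V -> Ck_on V 1 w -> Ck_on U 1 w.
Proof.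
move=> UV [cw dw]; split=> [x /UV|i]; first exact: cw.
have [dwi [cpw _]] := dw i.
by split=> [x /UV|]; [exact: dwi|split=> // x /UV; exact: cpw].
Qed.

Lemma continuous_on_eq U w f : open U -> (forall x, U x -> w x = f x) ->
  continuous_on U f -> continuous_on U w.
Proof.
move=> oU wf cf x Ux; rewrite /prop_for /continuous_at (wf _ Ux).
apply: cvg_trans (cf x Ux); apply: near_eq_cvg.
have : \forall y \near x, U y by exact: open_nbhs_nbhs.
by apply: filterS => y /wf.
Qed.

(** On an open set the values of the derivative determine its continuity, so that
    [partial i w] may be replaced by any formula [dw i] valid on the set. *)
Lemma Ck1_intro U w (dw : 'I_2 -> R * R -> R) : open U -> continuous_on U w ->
  (forall i x, U x -> is_derive x (basis i) w (dw i x)) ->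
  (forall i, continuous_on U (dw i)) -> Ck_on U 1 w.
Proof.
move=> oU cw hdw cdw; split => // i; split=> [x Ux|].
  by have [] := hdw i x Ux.
split=> //; apply: (continuous_on_eq oU) (cdw i) => x Ux.
by have [] := hdw i x Ux.
Qed.

Lemma Ck1_is_derive U w i x : Ck_on U 1 w -> U x ->
  is_derive x (basis i) w (partial i w x).
Proof. by move=> cw Ux; split => //; exact: Ck1_derivable Ux. Qed.

Lemma is_derive_prod f g i x (df dg : R) :
  is_derive x (basis i) f df -> is_derive x (basis i) g dg ->
  is_derive x (basis i) (fun y => f y * g y) (df * g x + f x * dg).
Proof.
move=> hf hg; apply: (is_derive_eq (is_deriveM hf hg)).
by rewrite addrC; congr (_ + _); exact: mulrC.
Qed.

Lemma partialM U f g i x : Ck_on U 1 f -> Ck_on U 1 g -> U x ->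
  partial i (fun y => f y * g y) x = partial i f x * g x + f x * partial i g x.
Proof.
move=> cf cg Ux.
by have [] := is_derive_prod (Ck1_is_derive i cf Ux) (Ck1_is_derive i cg Ux).
Qed.

Lemma partialB U f g i x : Ck_on U 1 f -> Ck_on U 1 g -> U x ->
  partial i (fun y => f y - g y) x = partial i f x - partial i g x.
Proof.
move=> cf cg Ux.
by apply: deriveB; apply: Ck1_derivable Ux.
Qed.

Lemma Ck1M U f g : open U -> Ck_on U 1 f -> Ck_on U 1 g ->
  Ck_on U 1 (fun y => f y * g y).
Proof.
move=> oU cf cg.
apply: (@Ck1_intro _ _ (fun i x => partial i f x * g x + f x * partial i g x)) => //.
- by move=> x Ux; apply: cvgM; apply: Ck1_continuous Ux.
- by move=> i x Ux; apply: is_derive_prod; apply: Ck1_is_derive Ux.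
- move=> i x Ux; apply: cvgD; apply: cvgM.
  + exact: (Ck1_partial cf Ux).
  + exact: (Ck1_continuous cg Ux).
  + exact: (Ck1_continuous cf Ux).
  + exact: (Ck1_partial cg Ux).
Qed.

Lemma Ck1B U f g : open U -> Ck_on U 1 f -> Ck_on U 1 g ->
  Ck_on U 1 (fun y => f y - g y).
Proof.
move=> oU cf cg.
apply: (@Ck1_intro _ _ (fun i x => partial i f x - partial i g x)) => //.
- by move=> x Ux; apply: cvgB; apply: Ck1_continuous Ux.
- by move=> i x Ux; apply: is_deriveB; apply: Ck1_is_derive Ux.
- by move=> i x Ux; apply: cvgB; apply: Ck1_partial Ux.
Qed.

Lemma Ck1_cst U (c : R) : open U -> Ck_on U 1 (cst c).
Proof.
move=> oU; apply: (@Ck1_intro _ _ (fun _ => cst 0)) => //.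
- by move=> x _; exact: cvg_cst.

- by move=> i x _; exact: cvg_cst.
Qed.

Lemma Ck1_comp U (h dh : R -> R) w : open U ->
  (forall s : R, is_derive s 1 h (dh s)) -> continuous dh -> Ck_on U 1 w ->
  Ck_on U 1 (h \o w).
Proof.
move=> oU hdh cdh cw.
apply: (@Ck1_intro _ _ (fun i x => dh (w x) * partial i w x)) => //.
- move=> x Ux; apply: continuous_comp; first exact: Ck1_continuous Ux.
  by apply/differentiable_continuous/derivable1_diffP; have [] := hdh (w x).
- by move=> i x Ux; apply: is_derive_comp => //; exact: Ck1_is_derive Ux.
- move=> i x Ux; apply: cvgM; last exact: Ck1_partial Ux.
  by apply: continuous_comp; [exact: Ck1_continuous Ux|exact: cdh].
Qed.

Lemma partial_comp U (h dh : R -> R) w i x :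
  (forall s : R, is_derive s 1 h (dh s)) -> Ck_on U 1 w -> U x ->
  partial i (h \o w) x = dh (w x) * partial i w x.
Proof.
by move=> hdh cw Ux; have [] := is_derive_comp (hdh (w x)) (Ck1_is_derive i cw Ux).
Qed.

Lemma Ck1_fst U : open U -> Ck_on U 1 fst.
Proof.
move=> oU; apply: (@Ck1_intro _ _ (fun i => cst (i == ord0)%:R)).
- exact: oU.
- by move=> x _; exact: cvg_fst.
- move=> i x _; have [b [s ->]] := lineP i x; apply/is_derive_line.
  rewrite /comp /line; case: (i == ord0) => /=; first exact: is_derive_id.
  exact: is_derive_cst.
- by move=> i x _; exact: cvg_cst.
Qed.

Lemma Ck1_snd U : open U -> Ck_on U 1 snd.
Proof.
move=> oU; apply: (@Ck1_intro _ _ (fun i => cst (i != ord0)%:R)).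
- exact: oU.
- by move=> x _; exact: cvg_snd.
- move=> i x _; have [b [s ->]] := lineP i x; apply/is_derive_line.
  rewrite /comp /line; case: (i == ord0) => /=; first exact: is_derive_cst.
  exact: is_derive_id.
- by move=> i x _; exact: cvg_cst.
Qed.

(** A localizing function: 1 on [box x0 d] and 0 outside [box x0 (2 * d)]. *)
Definition bump (x0 : R * R) (d : R) x : R :=
  plateau (d^-1 * (x.1 - x0.1)) * plateau (d^-1 * (x.2 - x0.2)).

Lemma Ck1_bump U x0 d : open U -> Ck_on U 1 (bump x0 d).
Proof.
move=> oU.
have T f (c : R) : Ck_on U 1 f -> Ck_on U 1 (fun x => plateau (d^-1 * (f x - c))).
  move=> cf; apply: (@Ck1_comp _ _ _ (fun x => d^-1 * (f x - c))).
  - exact: oU.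
  - exact: is_derive_plateau.
  - exact: continuous_dplateau.
  - exact: (Ck1M oU (Ck1_cst _ oU) (Ck1B oU cf (Ck1_cst _ oU))).
exact: (Ck1M oU (T _ _ (Ck1_fst oU)) (T _ _ (Ck1_snd oU))).
Qed.

Let norm_rescale (a b d : R) : 0 < d -> `|d^-1 * (a - b)| = d^-1 * `|b - a|.
Proof. by move=> d0; rewrite normrM normfV (gtr0_norm d0) distrC. Qed.

Lemma bump1 x0 d x : 0 < d -> box x0 d x -> bump x0 d x = 1.
Proof.
move=> d0 /boxE[h1 h2]; rewrite /bump !plateau1 ?mul1r//.
- by rewrite norm_rescale// ler_pdivrMl// mulr1.
- by rewrite norm_rescale// ler_pdivrMl// mulr1.
Qed.

Lemma bump0 x0 d x : 0 < d -> ~ box x0 (2 * d) x -> bump x0 d x = 0.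
Proof.
move=> d0 /boxE/not_andP[|] /negP; rewrite -ltNge => /ltW h.
- rewrite /bump plateau0 ?mul0r//.
  by rewrite norm_rescale// ler_pdivlMl// mulrC.
- rewrite /bump (@plateau0 _ (_ * (x.2 - _))) ?mulr0//.
  by rewrite norm_rescale// ler_pdivlMl// mulrC.
Qed.

End C1_calculus.

(** * Area of a set with short sections *)

Section strip.
Context {R : realType}.
Implicit Types (U omega S : set (R * R)) (w f r : R * R -> R) (i j : 'I_2).

(** Cavalieri's principle in either direction; for the sections along the first
    coordinate it needs the uniqueness of the product measure. *)
Lemma leb2_sections i S : measurable S ->
  (leb2 S = \int[lebesgue_measure]_b lebesgue_measure [set s | S (line i b s)])%E.
Proof.
move=> mS; rewrite /line; case: (i == ord0).
  rewrite (_ : leb2 S = (lebesgue_measure \x^ lebesgue_measure)%E S).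
    by apply: eq_integral => b _; congr lebesgue_measure; apply/seteqP; split => s;
      rewrite /ysection /= inE.
  by apply: product_measure_unique => //= B C mB mC; rewrite product_measure2E.
by apply: eq_integral => b _; congr lebesgue_measure; apply/seteqP; split => s;
  rewrite /xsection /= inE.
Qed.

Lemma measurable_section i b S : measurable S -> measurable [set s | S (line i b s)].
Proof.
move=> mS; rewrite /line; case: (i == ord0).
  have := measurable_ysection b mS.
  by congr measurable; apply/seteqP; split => s; rewrite /ysection /= inE.
have := measurable_xsection b mS.
by congr measurable; apply/seteqP; split => s; rewrite /xsection /= inE.
Qed.

Lemma box_line x0 (d : R) i b s : box x0 d (line i b s) ->
  let c := if i == ord0 then x0.2 else x0.1 in `[c - d, c + d]%classic b.
Proof.
move=> /boxE; rewrite /line /=; case: (i == ord0) => /= -[h1 h2];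
  by rewrite in_itv /= -ler_distlC.
Qed.

Lemma leb2_le_sections S i x0 (d a : R) : measurable S -> 0 <= d -> 0 <= a ->
  S `<=` box x0 d ->
  (forall b s t, S (line i b s) -> S (line i b t) -> `|s - t| <= a) ->
  (leb2 S <= (4 * d * a)%:E)%E.
Proof.
move=> mS d0 a0 Sb Sa.
pose c := if i == ord0 then x0.2 else x0.1.
have lebI (u v : R) : 0 <= v -> 
  lebesgue_measure (`[u - v, u + v]%classic : set R) = (2 * v)%:E.
  move=> v0; rewrite lebesgue_measure_itv /= lte_fin.
  have [|] := ltP (u - v) (u + v); rewrite -?EFinD => h; congr EFin; lra.
rewrite (leb2_sections i mS).
pose I : set R := `[c - d, c + d]%classic.
have -> : (4 * d * a)%:E = (\int[lebesgue_measure]_(b in I) (2 * a)%:E)%E.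
  rewrite integral_cst; last exact: measurable_itv.
  by rewrite [X in (_ * X)%E](lebI c d d0) -EFinM; congr EFin; ring.
rewrite [leRHS]integral_mkcond; apply: ge0_le_integral => //.
- rewrite /line; case: (i == ord0).
    apply: eq_measurable_fun (measurable_fun_ysection lebesgue_measure mS) => b _.
    by congr lebesgue_measure; apply/seteqP; split => s; rewrite /ysection /= inE.
  apply: eq_measurable_fun (measurable_fun_xsection lebesgue_measure mS) => b _.
  by congr lebesgue_measure; apply/seteqP; split => s; rewrite /xsection /= inE.
- have mI : measurable I by exact: measurable_itv.
  apply: (measurable_restrictT (fun=> (2 * a)%:E) mI).1.
  exact: measurable_cst.
- move=> b _; rewrite patchE; case: ifPn => [_|/negP]; last first.
    rewrite inE => nb; rewrite (_ : [set s | _] = set0) ?measure0//.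
    by apply/seteqP; split => // s /= /Sb /box_line.
  have [[s0 Ss0]|nS] := pselect (exists s, S (line i b s)); last first.
    rewrite (_ : [set s | _] = set0) ?measure0 ?lee_fin ?mulr_ge0//.
    by apply/seteqP; split => // s Ss; apply: nS; exists s.
  rewrite -(lebI s0 a a0); apply: le_measure.
  + by rewrite inE; exact: measurable_section.
  + by rewrite inE; exact: measurable_itv.
  + move=> s /= Ss; rewrite in_itv /= -ler_distlC; exact: Sa Ss.
Qed.

End strip.

(** * Tangential fields and cutoffs *)

Section divergence.
Context {R : realType}.
Implicit Types (U omega : set (R * R)) (w f r psi : R * R -> R) (i j : 'I_2)
  (W : 'I_2 -> R * R -> R).

Definition div2 W x : R := \sum_(i < 2) partial i (W i) x.

Definition flux W r x : R := \sum_(i < 2) W i x * partial i r x.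

Lemma sum2 (F : 'I_2 -> R) : \sum_(i < 2) F i = F ord0 + F ord_max.
Proof.
by rewrite big_ord_recr big_ord1 /=; congr (F _ + _); exact/val_inj.
Qed.

(** The last clause says that the normal component vanishes on the boundary. It is
    a limit from inside, as [W] is only meaningful in [omega], and it uses the
    gradient of a defining function in place of the unit normal. *)
Definition tangential omega W :=
  [/\ forall i, Ck_on omega 1 (W i),
      forall i, bounded_on omega (W i),
      forall i, bounded_on omega (partial i (W i)) &
      forall z U r, bd omega z -> C2_chart omega z U r ->
        flux W r x @[x --> within omega (nbhs z)] --> (0 : R)].

Lemma Ck1_of_chart omega z U r : C2_chart omega z U r -> Ck_on U 1 r.
Proof.
move=> [_ _ [cr dr] _ _]; split=> // i.
by have [dri [cri _]] := dr i; split.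
Qed.

Lemma div2_integrable omega W : open omega -> bounded_set omega ->
  tangential omega W ->
  leb2.-integrable omega (EFin \o div2 W) /\
  exists2 M, 0 <= M & forall x, omega x -> `|div2 W x| <= M.
Proof.
move=> oo bo [cW bW bdW _].
have [M0 M00 hM0] := bounded_on_ge0 (bdW ord0).
have [M1 M10 hM1] := bounded_on_ge0 (bdW ord_max).
have b : exists2 M, 0 <= M & forall x, omega x -> `|div2 W x| <= M.
  exists (M0 + M1) => [|x ox]; first exact: addr_ge0.
  rewrite /div2 sum2.
  by apply: le_trans (ler_normD _ _) _; apply: lerD; [exact: hM0|exact: hM1].
split=> //; apply: continuous_on_integrable => //; last by have [M _ ?] := b; exists M.
have -> : div2 W = fun x => partial ord0 (W ord0) x + partial ord_max (W ord_max) x.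
  by apply/funext => x; rewrite /div2 sum2.
by move=> x ox; apply: cvgD; apply: Ck1_partial ox.
Qed.

Lemma bounded_on_C1 omega psi : bounded_set omega -> Ck_on setT 1 psi ->
  bounded_on omega psi /\ forall i, bounded_on omega (partial i psi).
Proof.
move=> bo cp.
have T w : continuous_on setT w -> bounded_on omega w.
  move=> cw; apply: bounded_on_closure => // z _; exists (`|w z| + 1).
  have /cvgr_norm_le := cw z I; move=> /(_ (`|w z| + 1)) /=.
  by rewrite ltrDl ltr01 => /(_ isT); apply: filterS => y + _; exact.
by split=> [|i]; apply: T; [exact: Ck1_continuous|exact: Ck1_partial].
Qed.

(** This stability under multiplication by smooth functions is what permits
    localization. *)
Lemma tangential_mul omega W psi : open omega -> bounded_set omega ->
  tangential omega W -> Ck_on setT 1 psi ->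
  tangential omega (fun i x => psi x * W i x).
Proof.
move=> oo bo [cW bW bdW fW] cp.
have cpo := Ck1_sub (@subsetT _ omega) cp.
have [[Mp hMp] bdp] := bounded_on_C1 bo cp.
split=> [i|i|i|z U r bz ch].
- exact: Ck1M.
- have [M hM] := bW i; exists (Mp * M) => x ox.
  by rewrite normrM; apply: ler_pM => //; [exact: hMp|exact: hM].
- have [M hM] := bW i; have [M' hM'] := bdW i; have [Mp' hMp'] := bdp i.
  exists (Mp' * M + Mp * M') => x ox; rewrite (partialM i cpo (cW i) ox).
  apply: le_trans (ler_normD _ _) _; rewrite !normrM.
  by apply: lerD; apply: ler_pM => //; auto.
- have -> : flux (fun i x => psi x * W i x) r = fun x => psi x * flux W r x.
    apply/funext => x; rewrite /flux mulr_sumr; apply: eq_bigr => i _.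
    by rewrite mulrA.
  rewrite -(mulr0 (psi z)); apply: cvgM; last exact: fW ch.
  apply: cvg_within_filter; exact: (Ck1_continuous cp).
Qed.

Lemma Ck1_zero U w : open U -> (forall x, U x -> w x = 0) -> Ck_on U 1 w.
Proof.
move=> oU w0.
have n x : U x -> \forall y \near x, cst 0 y = w y.
  move=> Ux; have : \forall y \near x, U y by exact: open_nbhs_nbhs.
  by apply: filterS => y /w0 ->.
apply: (@Ck1_intro _ _ _ (fun _ => cst 0)) => //.
- apply: (continuous_on_eq oU w0) => x _; exact: cvg_cst.
- move=> i x /n nx; apply: near_eq_is_derive nx _; exact: is_derive_cst.
- by move=> i x _; exact: cvg_cst.
Qed.

Lemma Ck1_union omega U V w : omega `<=` U `|` V ->
  Ck_on (omega `&` U) 1 w -> Ck_on (omega `&` V) 1 w -> Ck_on omega 1 w.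
Proof.
move=> sub [cU dU] [cV dV].
have T (P : R * R -> Prop) : (forall x, (omega `&` U) x -> P x) ->
    (forall x, (omega `&` V) x -> P x) -> forall x, omega x -> P x.
  by move=> PU PV x ox; case: (sub x ox) => [Ux|Vx]; [exact: PU|exact: PV].
split=> [|i]; first exact: T.
have [dUi [cUi _]] := dU i; have [dVi [cVi _]] := dV i.
by split; [exact: T|split=> //; exact: T].
Qed.

Lemma partial_zero U w i x : open U -> (forall x, U x -> w x = 0) -> U x ->
  partial i w x = 0.
Proof.
move=> oU w0 Ux.
have : \forall y \near x, w y = cst 0 y.
  have : \forall y \near x, U y by exact: open_nbhs_nbhs.
  by apply: filterS => y /w0 ->.
by move=> /near_partial/nbhs_singleton ->; exact: partial_cst.
Qed.

Definition vanishes_outside omega (B : set (R * R)) W :=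
  forall i x, omega x -> ~ B x -> W i x = 0.

Lemma div2_compact_support omega K W : open omega ->
  (forall i, Ck_on omega 1 (W i)) -> compact K -> K `<=` omega ->
  vanishes_outside omega K W ->
  leb2.-integrable omega (EFin \o div2 W) /\ int2 omega (div2 W) = 0.
Proof.
move=> oo cW cK Ko W0; have mo := open_measurable2 oo.
have zW i : leb2.-integrable omega (EFin \o partial i (W i)) /\
    int2 omega (partial i (W i)) = 0.
  apply: (int2_partial_compact_support oo cK Ko).
  - by move=> x; exact: Ck1_derivable.
  - exact: Ck1_partial.
  - by move=> x ox; exact: W0.
have [[i0 z0] [i1 z1]] := (zW ord0, zW ord_max).
have -> : div2 W = fun x => partial ord0 (W ord0) x + partial ord_max (W ord_max) x.
  by apply/funext => x; rewrite /div2 sum2.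
split; first by have := integrableD _ i0 i1; apply.
by rewrite /int2 RintegralD// -!/(int2 _ _) z0 z1 addr0.
Qed.

Lemma int2_supported omega S w (M : R) : open omega -> bounded_set omega ->
  measurable S -> S `<=` omega -> leb2.-integrable omega (EFin \o w) ->
  (forall x, S x -> `|w x| <= M) -> (forall x, omega x -> ~ S x -> w x = 0) ->
  `|int2 omega w| <= M * area S.
Proof.
move=> oo bo mS So iw wM w0; have mo := open_measurable2 oo.
have -> : int2 omega w = int2 S w.
  rewrite /int2 Rintegral_mkcond [in RHS]Rintegral_mkcond.
  apply: eq_Rintegral => x _; rewrite !patchE.
  case: ifPn; case: ifPn => //; rewrite ?inE ?notin_setE => Sx ox.
  - exact: w0.
  - by case: ox; exact: So.
apply: norm_int2_le => //.
- apply: le_lt_trans (leb2_bounded mo bo).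
  by apply: le_measure => //; rewrite inE.
- exact: integrableS iw.
Qed.

(** Near a boundary point some fixed partial derivative of the defining function
    stays away from 0, by continuity. *)
Lemma chart_box omega x0 U r : C2_chart omega x0 U r ->
  exists i (d c : R), [/\ 0 < d, 0 < c, box x0 d `<=` U &
    forall y, box x0 d y -> c <= `|partial i r y|].
Proof.
move=> ch; have [oU Ux0 _ [i ri0] _] := ch.
have cr := Ck1_of_chart ch.
pose c : R := `|partial i r x0| / 2.
have n0 : 0 < `|partial i r x0| by rewrite normr_gt0.
have c0 : 0 < c by rewrite /c; lra.
have nU : \forall y \near x0, U y by exact: open_nbhs_nbhs.
have nc : \forall y \near x0, c <= `|partial i r y|.
  have /cvgr_norm_ge := @Ck1_partial _ _ _ i cr _ Ux0.
  by apply; rewrite /c; lra.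
have [d d0 hd] := (nbhs_boxP _ _).1 (filterI nU nc).
by exists i, d, c; split => // y /hd[].
Qed.

(** Along the lines in a direction in which [r] is transversal, [r] is strictly
    monotone with slope at least [c]: a strip of depth [e] meets such a line in
    a set of diameter at most [e / c]. *)
Lemma strip_section r i (c : R) U x0 d b (s t e : R) : Ck_on U 1 r -> 0 < c ->
  box x0 d `<=` U -> (forall y, box x0 d y -> c <= `|partial i r y|) ->
  box x0 d (line i b s) -> box x0 d (line i b t) ->
  - e < r (line i b s) < 0 -> - e < r (line i b t) < 0 -> `|s - t| <= e / c.
Proof.
move=> cr c0 bU hc.
wlog st : s t / s <= t.
  move=> H; have [st|/ltW ts] := leP s t; first exact: H.
  by move=> *; rewrite distrC; exact: H.
move=> bs bt rs rt.
have bu u : s <= u <= t -> box x0 d (line i b u).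
  move=> /andP[su ut]; move: bs bt; rewrite /box /line.
  by case: (i == ord0); rewrite /= !in_itv /= => -[/andP[? ?] /andP[? ?]]
    [/andP[? ?] /andP[? ?]]; split; apply/andP; split; lra.
have dr u : s <= u <= t -> is_derive u 1 (r \o line i b) (partial i r (line i b u)).
  by move=> /bu /bU Uu; apply/is_derive_line; exact: Ck1_is_derive Uu.
have [u ust E] : exists2 u, u \in `[s, t]%R &
    (r \o line i b) t - (r \o line i b) s = partial i r (line i b u) * (t - s).
  apply: MVT_segment => // [u|].
    by rewrite in_itv /= => /andP[/ltW su /ltW ut]; apply: dr; rewrite su.
  apply: derivable_within_continuous => u; rewrite in_itv /= => sut.
  by have [] := dr u sut.
move: ust; rewrite in_itv /= => /bu /hc cu.
rewrite distrC ler_pdivlMr// mulrC.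
apply: (@le_trans _ _ `|partial i r (line i b u) * (t - s)|).
  by rewrite normrM; apply: ler_pM => //; exact: ltW.
by rewrite -E /= ler_norml; move: rs rt => /andP[? ?] /andP[? ?]; apply/andP; split; lra.
Qed.

End divergence.

(** * Localization at a boundary point *)

Section divergence2.
Context {R : realType}.
Implicit Types (U omega : set (R * R)) (w f r psi : R * R -> R) (i j : 'I_2)
  (W : 'I_2 -> R * R -> R).

(** The pointwise limit 0 of [flux W r] at the boundary is uniform on a compact
    box. The covering argument treats three kinds of points of the box: those off
    the closure, near which there is nothing to prove; those of [omega], near which
    [r] stays below a negative number; and boundary points, for which the chart at
    [x0] is still a chart. *)
Lemma flux_small omega W x0 U r i (d c eta : R) : open omega -> tangential omega W ->
  C2_chart omega x0 U r -> box x0 d `<=` U -> 0 < c ->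
  (forall y, box x0 d y -> c <= `|partial i r y|) -> 0 < eta ->
  exists2 e : R, 0 < e & forall x, box x0 d x -> omega x -> - e < r x ->
    `|flux W r x| <= eta.
Proof.
move=> oo [_ _ _ fW] ch bU c0 hc eta0.
have cr := Ck1_of_chart ch; have [oU Ux0 C2r _ ho] := ch.
have /compact_near_coveringP := @compact_box _ x0 d.
move=> /(_ R (0^'+) (fun e x => omega x -> - e < r x -> `|flux W r x| <= eta) _) cov.
have : forall x, box x0 d x ->
    \forall x' \near x & e \near 0^'+, omega x' -> - e < r x' -> `|flux W r x'| <= eta.
  move=> z bz; have Uz := bU _ bz.
  have [cz|ncz] := pselect (closure omega z); last first.
    have nz : \forall x \near z, ~ closure omega x.
      by apply: open_nbhs_nbhs; split => //; exact/closed_openC/closed_closure.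
    near=> x e => /= ox; exfalso.
    have : ~ closure omega x by near: x.
    by apply; exact: subset_closure.
  have [oz|noz] := pselect (omega z).
    have rz : r z < 0 by apply/ho.
    have nz : \forall x \near z, r x < r z / 2.
      by have /cvgr_lt := Ck1_continuous cr Uz; apply; lra.
    have ne : \forall e \near 0^'+, e < - r z / 2.
      by apply: nbhs_right_lt; lra.
    near=> x e => /= ox re; exfalso.
    have : r x < r z / 2 by near: x.
    have : e < - r z / 2 by near: e.
    by lra.
  have bdz : bd omega z by split=> // /interior_subset.
  have chz : C2_chart omega z U r.
    split=> //; exists i; rewrite -normr_gt0; exact: lt_le_trans (hc _ bz).
  have /cvgr0_norm_le /(_ _ eta0) := fW _ _ _ bdz chz.
  rewrite near_withinE => nz.
  near=> x e => /= ox _; move: ox.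
  by near: x.
move=> /cov n.
have /filter_ex[e [e0 he]] : \forall e \near (0 : R)^'+, 0 < e /\
    box x0 d `<=` (fun x => omega x -> - e < r x -> `|flux W r x| <= eta).
  by apply: filterS2 n (nbhs_right_gt 0) => e.
by exists e.
Unshelve. all: by end_near. Qed.

Lemma eq0_of_arbitrarily_small (a B : R) : 0 <= B ->
  (forall e, 0 < e -> `|a| <= e * B) -> a = 0.
Proof.
move=> B0 h; apply/eqP; rewrite -normr_eq0 eq_le normr_ge0 andbT.
apply/ler_addgt0Pl => e e0; rewrite addr0.
have B1 : 0 < B + 1 by lra.
have := h (e / (B + 1)) (divr_gt0 e0 B1).
move/le_trans; apply; rewrite mulrAC ler_pdivrMr//; nra.
Qed.

(** With a cutoff that removes the strip [- e < r], only an integral over the strip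
    [- (2 * e) < r] remains; the integrand there is at most [M + 16 * (e^-1 * eta)]
    and the area at most [C * (2 * e)]. The bound tends to 0 because [eta] may be
    chosen first and then [e] below [eta]. *)
Lemma boundary_local omega x0 U r : open omega -> bounded_set omega ->
  C2_chart omega x0 U r ->
  exists2 d : R, 0 < d & forall W, tangential omega W ->
    vanishes_outside omega (box x0 d) W -> int2 omega (div2 W) = 0.
Proof.
move=> oo bo ch; have [i [d [c [d0 c0 bU hc]]]] := chart_box ch.
exists d => // W tW W0.
have cr := Ck1_of_chart ch; have [oU Ux0 C2r _ ho] := ch.
have mo := open_measurable2 oo.
have [iW [M M0 hM]] := div2_integrable oo bo tW.
have [cW bW bdW fW] := tW.
have r0 x : box x0 d x -> omega x -> r x < 0.
  by move=> /bU Ux ox; apply/ho.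
have oQ : open (~` box x0 d) by exact/closed_openC/closed_box.
pose C : R := 8 * d / c.
pose strip e := [set x | box x0 d x /\ omega x /\ - e < r x].
have mstrip e : measurable (strip e).
  rewrite (_ : strip e = box x0 d `&` [set x | (U `&` omega) x /\ - e < r x]); last first.
    by apply/seteqP; split=> x [bx]; [move=> [ox rx]; split=> //; do 2 split => //; exact: bU|
      move=> [[Ux ox] rx]; split].
  apply: measurableI; first exact: measurable_box.
  apply: open_measurable2; rewrite openE => x [[Ux ox] rx].
  apply: filterI; first exact: open_nbhs_nbhs (conj (openI oU oo) _).
  by have /cvgr_gt := Ck1_continuous cr Ux; exact.
have astrip e : 0 < e -> area (strip e) <= C * e.
  move=> e0.
  have hs : (leb2 (strip e) <= (4 * d * (e / c))%:E)%E.
    apply: (@leb2_le_sections _ _ i x0) => //; [exact: ltW|exact/ltW/divr_gt0|by move=> x []|].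
    move=> b s t [bs [os rs]] [bt [ot rt]].
    by apply: (strip_section cr c0 bU hc bs bt); rewrite ?rs ?rt /=; exact: r0.
  rewrite /area -lee_fin fineK; last first.
    by rewrite ge0_fin_numE//; apply: le_lt_trans hs _; rewrite ltry.
  apply: le_trans hs _; rewrite lee_fin /C.
  by rewrite -!mulrA (mulrC e) !mulrA; apply: ler_wpM2r; [lra|];
     apply: ler_wpM2r; [rewrite invr_ge0; lra|lra].
apply: (@eq0_of_arbitrarily_small _ (2 * M * C + 32 * C)).
  have C0 : 0 <= C by rewrite /C divr_ge0 ?ltW// mulr_gt0.
  by have := mulr_ge0 M0 C0; lra.
move=> eta eta0.
have [e1 e10 he1] := flux_small oo tW ch bU c0 hc eta0.
pose e := Num.min (e1 / 2) eta.
have e0 : 0 < e by rewrite lt_min eta0 andbT divr_gt0.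
have ee1 : 2 * e <= e1 by rewrite -ler_pdivlMl// mulrC ge_min lexx.
have eeta : e <= eta by rewrite ge_min lexx orbT.
(* chi is 0 where - e <= r <= 0 and 1 where r <= - (2 * e) *)
pose g x := e^-1 * r x.
have cg : Ck_on U 1 g by exact: (Ck1M oU (Ck1_cst _ oU) cr).
pose chi x := 1 - plateau (g x).
have cp : Ck_on U 1 (plateau \o g).
  by apply: (Ck1_comp oU (@is_derive_plateau R)) => //; exact: continuous_dplateau.
have cchi : Ck_on U 1 chi by exact: (Ck1B oU (Ck1_cst 1 oU) cp).
have dchi j x : U x -> partial j chi x = - (dplateau (g x) * (e^-1 * partial j r x)).
  move=> Ux; rewrite (partialB j (Ck1_cst 1 oU) cp Ux) partial_cst sub0r.
  rewrite (partial_comp j (@is_derive_plateau R) cg Ux).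
  by rewrite (partialM j (Ck1_cst _ oU) cr Ux) partial_cst mul0r add0r.
pose V j x := chi x * W j x.
have oUo : open (omega `&` U) by exact: openI.
have ooQ : open (omega `&` ~` box x0 d) by exact: openI.
have V0 j x : (omega `&` ~` box x0 d) x -> V j x = 0.
  by move=> [ox bx]; rewrite /V W0 ?mulr0.
have cUW j : Ck_on (omega `&` U) 1 (W j) by apply: Ck1_sub (cW j) => x [].
have cUchi : Ck_on (omega `&` U) 1 chi by apply: Ck1_sub cchi => x [].
have cV j : Ck_on omega 1 (V j).
  (* r is only controlled on U, but off the box W vanishes *)
  apply: (@Ck1_union _ _ U (~` box x0 d)).
  - by move=> x _; have [/bU|] := pselect (box x0 d x); [left|right].
  - exact: (Ck1M oUo cUchi (cUW j)).
  - apply: Ck1_zero => //; exact: V0.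
(* closed although omega is open: r <= - e keeps K inside omega *)
pose K := box x0 d `&` [set x | r x <= - e].
have KU : K `<=` omega.
  by move=> x [/bU Ux rx]; apply/ho => //; apply: le_lt_trans rx _; rewrite oppr_lt0.
have cK : compact K.
  apply: (@subclosed_compact _ _ (box x0 d)); [|exact: compact_box|by move=> x []].
  rewrite -[K]setCK; apply: open_closedC; rewrite openE => x Kx.
  have [bx|nbx] := pselect (box x0 d x); last first.
    have : nbhs x (~` box x0 d) by exact: open_nbhs_nbhs.
    by apply: filterS => y nby [].
  have rx : - e < r x by rewrite ltNge; apply/negP => rx; exact: Kx.
  have /cvgr_gt /(_ _ rx) := Ck1_continuous cr (bU _ bx).
  by apply: filterS => y ry [_ /=]; rewrite leNgt ry.
have gE x : `|g x| = e^-1 * `|r x| by rewrite normrM normfV (gtr0_norm e0).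
have VK : vanishes_outside omega K V.
  move=> j x ox Kx.
  have [bx|nbx] := pselect (box x0 d x); last exact: V0.
  have rx : - e < r x by rewrite ltNge; apply/negP => rx; exact: Kx.
  rewrite /V /chi plateau1 ?subrr ?mul0r// gE ler_pdivrMl// mulr1.
  by rewrite ltr0_norm; [lra|exact: r0].
have [iV zV] := div2_compact_support oo cV cK KU VK.
pose G x := div2 W x - div2 V x.
have intG : int2 omega (div2 W) = int2 omega G.
  by rewrite [RHS]RintegralB// -/(int2 _ _) -/(int2 _ _) zV subr0.
have iG : leb2.-integrable omega (EFin \o G) by have := integrableB _ iW iV; apply.
have GE x : omega x -> box x0 d x ->
    G x = plateau (g x) * div2 W x + e^-1 * dplateau (g x) * flux W r x.
  move=> ox /bU Ux; rewrite /G /div2 /flux !sum2 !(partialM _ cUchi (cUW _) (conj ox Ux)).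
  by rewrite !dchi// /chi; ring.
have G0 x : omega x -> ~ strip (2 * e) x -> G x = 0.
  move=> ox sx; have [bx|nbx] := pselect (box x0 d x); last first.
    have Z := conj ox nbx.
    have zV' j : partial j (V j) x = 0 by exact: (partial_zero j ooQ (V0 j) Z).
    have zW' j : partial j (W j) x = 0.
      by apply: (partial_zero j ooQ _ Z) => y [oy by_]; exact: W0.
    by rewrite /G /div2 !sum2 !zV' !zW' subrr.
  have rx : r x <= - (2 * e) by rewrite leNgt; apply/negP => rx; exact: sx.
  have g2 : 2 <= `|g x|.
    by rewrite gE ler_pdivlMl// ler0_norm; [rewrite lerNr mulrC|exact/ltW/r0].
  by rewrite GE// plateau0// dplateau0// mulr0 !mul0r addr0.
have GM x : strip (2 * e) x -> `|G x| <= M + 16 * (e^-1 * eta).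
  move=> [bx [ox rx]]; rewrite GE//; apply: le_trans (ler_normD _ _) _.
  apply: lerD.
    rewrite normrM -[M]mul1r; apply: ler_pM => //; last exact: hM.
    by rewrite ger0_norm; [exact: plateau_le1|exact: plateau_ge0].
  have -> : 16 * (e^-1 * eta) = e^-1 * 16 * eta by ring.
  rewrite normrM (normrM e^-1); apply: ler_pM => //.
    rewrite normfV (gtr0_norm e0); apply: ler_wpM2l; first by rewrite invr_ge0 ltW.
    exact: dplateau_le.
  by apply: he1 => //; apply: le_lt_trans rx; rewrite lerN2.
rewrite intG; apply: le_trans (int2_supported oo bo (mstrip _) _ iG GM G0) _.
  by move=> x [_ []].
have e20 : 0 < 2 * e by rewrite mulr_gt0.
have Mge : 0 <= M + 16 * (e^-1 * eta).
  by rewrite addr_ge0// mulr_ge0// mulr_ge0 ?invr_ge0 ?ltW.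
apply: le_trans (ler_wpM2l Mge (astrip _ e20)) _.
have -> : (M + 16 * (e^-1 * eta)) * (C * (2 * e)) = e * (2 * M * C) + eta * (32 * C).
  by field; rewrite gt_eqF.
have C0 : 0 <= C by rewrite /C divr_ge0 ?ltW// mulr_gt0.
by rewrite mulrDr lerD2r; apply: ler_wpM2r eeta; rewrite -mulrA mulr_ge0// mulr_ge0.
Qed.

End divergence2.

(** * The divergence theorem for tangential fields *)

Section divergence3.
Context {R : realType}.
Implicit Types (U omega : set (R * R)) (w f r psi : R * R -> R) (i j : 'I_2)
  (W : 'I_2 -> R * R -> R).

Definition localized omega (x0 : R * R) (d : R) := forall W, tangential omega W ->
  vanishes_outside omega (box x0 d) W -> int2 omega (div2 W) = 0.

Lemma localized_closure omega x0 : open omega -> bounded_set omega ->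
  C2_boundary omega -> closure omega x0 ->
  exists2 d : R, 0 < d & localized omega x0 d.
Proof.
move=> oo bo C2o cx.
have [ox|nox] := pselect (omega x0).
  have /nbhs_boxP[d d0 dob] : nbhs x0 omega by exact: open_nbhs_nbhs.
  exists d => // W [cW _ _ _] W0.
  by have [] := div2_compact_support oo cW (@compact_box _ x0 d) dob W0.
have [U [r ch]] := C2o _ (conj cx (fun ix => nox (interior_subset ix))).
exact: boundary_local ch.
Qed.

(** Induction on the list of boxes that carry [W]: with a bump function [psi] of
    the first box, [psi W] is localized there, and [(1 - psi) W] is carried by the
    remaining boxes because [psi] is 1 on the smaller box. *)
Lemma divergence_cover omega (rad : R * R -> R) (s : seq (R * R)) W :
  open omega -> bounded_set omega ->
  (forall z, z \in s -> 0 < rad z /\ localized omega z (2 * rad z)) ->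
  tangential omega W ->
  (forall i x, omega x -> (forall z, z \in s -> ~ box z (rad z) x) -> W i x = 0) ->
  int2 omega (div2 W) = 0.
Proof.
move=> oo bo; elim: s W => [|z s IH] W hs tW W0.
  have Z i x : omega x -> W i x = 0 by move=> ox; apply: W0.
  transitivity (int2 omega (cst 0)); last by rewrite /int2 Rintegral_cst ?mul0r//; exact: open_measurable2.
  apply: eq_int2 => x ox; rewrite /div2 sum2.
  by rewrite !(partial_zero _ oo (Z _) ox) addr0.
have [z0 lz] := hs z (mem_head _ _).
have cp : Ck_on setT 1 (bump z (rad z)) by apply: Ck1_bump; exact: openT.
have cp' : Ck_on setT 1 (fun x => 1 - bump z (rad z) x).
  exact: (Ck1B openT (Ck1_cst 1 openT) cp).
have t1 := tangential_mul oo bo tW cp; have t2 := tangential_mul oo bo tW cp'.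
have [i1 _] := div2_integrable oo bo t1; have [i2 _] := div2_integrable oo bo t2.
have cpo := Ck1_sub (@subsetT _ omega) cp.
have cpo' := Ck1_sub (@subsetT _ omega) cp'.
have [cW _ _ _] := tW.
rewrite (@eq_int2 _ _ _ (fun x => div2 (fun i x => bump z (rad z) x * W i x) x +
   div2 (fun i x => (1 - bump z (rad z) x) * W i x) x)); last first.
  move=> x ox; rewrite /div2 !sum2.
  rewrite !(partialM _ cpo (cW _) ox) !(partialM _ cpo' (cW _) ox).
  rewrite (partialB ord0 (Ck1_cst 1 oo) cpo ox) (partialB ord_max (Ck1_cst 1 oo) cpo ox).
  by rewrite !partial_cst; ring.
rewrite /int2 RintegralD//; last exact: open_measurable2.
rewrite -!/(int2 _ _) lz//; last first.
  by move=> i x ox bx; rewrite bump0 ?mul0r.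
rewrite add0r; apply: IH => // [y ys|i x ox nb].
  by apply: hs; rewrite inE ys orbT.
have [bx|nbx] := pselect (box z (rad z) x).
  by rewrite bump1 ?subrr ?mul0r.
rewrite W0 ?mulr0// => y; rewrite inE => /orP[/eqP ->//|]; exact: nb.
Qed.

(** Gauss' theorem *)
(** The finite subcover of the closure is extracted with the filter generated by
    the sets of lists that contain a given list. *)
Lemma divergence_tangential omega W : open omega -> bounded_set omega ->
  C2_boundary omega -> tangential omega W -> int2 omega (div2 W) = 0.
Proof.
move=> oo bo C2o tW.
have loc x : {d : R | closure omega x -> 0 < d /\ localized omega x d}.
  apply: cid; have [cx|] := pselect (closure omega x); last by exists 0.
  by have [d d0 ld] := localized_closure oo bo C2o cx; exists d.
(* the bump function of radius rad x is supported in a box of radius 2 * rad x *)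
pose rad x := sval (loc x) / 2.
have radP x : closure omega x -> 0 < rad x /\ localized omega x (2 * rad x).
  move=> cx; rewrite /rad; case: (loc x) => d /= /(_ cx)[d0 ld].
  by split; [lra|rewrite mulrC divfK].
pose F : set_system (seq (R * R)) :=
  filter_from setT (fun s0 : seq (R * R) => [set s : seq (R * R) | {subset s0 <= s}]).
have FF : Filter F.
  apply: filter_from_filter; first by exists [::].
  move=> s1 s2 _ _; exists (s1 ++ s2) => // s /= hs.
  by split=> z zs; apply: hs; rewrite mem_cat zs ?orbT.
have /compact_near_coveringP := compact_closure_bounded bo.
move=> /(_ _ F (fun s x => exists2 z, z \in s & closure omega z /\ box z (rad z) x) FF).
case=> [x cx|s0 _ /(_ s0 (fun _ h => h)) cov].
  exists (box x (rad x), [set s : seq (R * R) | {subset [:: x] <= s}]).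
    split; first by apply/nbhs_boxP; exists (rad x) => //; exact: (radP x cx).1.
    by exists [:: x].
  move=> [y s] /= [yx xs]; exists x => //.
  by apply: xs; rewrite inE.
apply: (@divergence_cover _ rad [seq z <- s0 | `[< closure omega z >]]) => //.
  by move=> z; rewrite mem_filter => /andP[/asboolP cz _]; exact: radP.
move=> i x ox nb; exfalso.
have [z zs [cz zx]] := cov x (subset_closure ox).
by apply: (nb z) zx; rewrite mem_filter zs andbT; apply/asboolP.
Qed.

End divergence3.

(** * Time slices and time derivatives of integrals *)

Section slices.
Context {R : realType} (omega : set (R * R)) (T : R).
Context (oo : open omega) (bo : bounded_set omega).
Implicit Types (w : @field R) (t : R) (x z : R * R) (i : 'I_2).

(** The joint limit in time and space, taken along a single time. *)
Lemma C0bar_slice w t z : C0bar omega T w -> 0 < t < T -> closure omega z ->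
  w t x @[x --> within omega (nbhs z)] --> trace omega T w t z.
Proof.
move=> cw tT cz.
have h : (t, x) @[x --> within omega (nbhs z)] --> within (cylinder omega T) (nbhs (t, z)).
  move=> A -[[B C] /= [nB nC] BC].
  suff : nbhs z (fun x => omega x -> A (t, x)) by [].
  apply: filterS nC => x Cx ox; apply: (BC (t, x)) => /=.
    by split => //=; exact: nbhs_singleton nB.
  by split => //=; rewrite in_itv.
exact: cvg_comp h (cw t z tT cz).
Qed.

Lemma within_open_nbhs z : omega z -> within omega (nbhs z) = nbhs z.
Proof.
move=> oz; apply: within_interior; rewrite /interior.
exact: open_nbhs_nbhs.
Qed.

Lemma cvg_value (f : R * R -> R) x (l : R) : f y @[y --> x] --> l -> l = f x.
Proof.
move=> /cvgrPdist_le h; apply/eqP; rewrite -subr_eq0; apply/eqP.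
apply: (@eq0_of_arbitrarily_small _ _ 1) => // e /h /nbhs_singleton; by rewrite mulr1.
Qed.

Lemma C0bar_continuous w t : C0bar omega T w -> 0 < t < T -> continuous_on omega (w t).
Proof.
move=> cw tT x ox.
have := C0bar_slice cw tT (subset_closure ox); rewrite within_open_nbhs// => h.
by move: (h); rewrite (cvg_value h).
Qed.

Lemma cvg_bounded_near w t z (l : R) : w t x @[x --> within omega (nbhs z)] --> l ->
  \forall x \near z, omega x -> `|w t x| <= `|l| + 1.
Proof.
move=> /cvgr_norm_le /(_ (`|l| + 1)); rewrite ltrDl ltr01 => /(_ isT).
by rewrite near_withinE.
Qed.

Lemma C0bar_bounded w t : C0bar omega T w -> 0 < t < T -> bounded_on omega (w t).
Proof.
move=> cw tT; apply: bounded_on_closure => // z cz.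
by eexists; exact: cvg_bounded_near (C0bar_slice cw tT cz).
Qed.

(** Compactness of the closure makes the bound near each point of the slice
    uniform in space; it also fixes a common time interval. *)
Lemma C0bar_locally_bounded w t : C0bar omega T w -> 0 < t < T ->
  exists e M : R, 0 < e /\ forall s x, `|t - s| < e -> omega x ->
    0 < s < T /\ `|w s x| <= M.
Proof.
move=> cw tT.
have /compact_near_coveringP := compact_closure_bounded bo.
move=> /(_ _ (filter_prod (nbhs t) (+oo : set_system R))
  (fun sM x => omega x -> 0 < sM.1 < T /\ `|w sM.1 x| <= sM.2) _) cov.
have n0T : \forall s \near t, 0 < s < T.
  have : nbhs t `]0, T[%classic.
    by apply: open_nbhs_nbhs; split; [exact: interval_open|rewrite /= in_itv].
  by apply: filterS => s; rewrite /= in_itv.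
case: cov => [z cz|[A B] /= [nA nB] cov].
  have /cvgr_norm_le := cw t z tT cz; set l := lim _.
  move=> /(_ (`|l| + 1)); rewrite ltrDl ltr01 => /(_ isT).
  rewrite near_withinE => -[[A B] /= [nA nB] AB].
  exists (B, (A `&` [set s | 0 < s < T]) `*` [set M | `|l| + 1 <= M])%classic.
    split => //; exists (A `&` [set s | 0 < s < T], [set M | `|l| + 1 <= M]).
      split => /=; first exact: filterI.
      by apply: nbhs_pinfty_ge; exact: num_real.
    by move=> [].
  move=> [x [s M]] [/= Bx [[As sT] lM]] ox; split => //.
  have cs : cylinder omega T (s, x) by split; rewrite /= ?in_itv.
  exact: le_trans (AB (s, x) (conj As Bx) cs) lM.
have [M BM] := filter_ex nB.
have /nbhs_ballP[e /= e0 eA] := nA.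
exists e, M; split => // s x ts ox.
by apply: (cov (s, M)) => //; [split => //; exact: eA|exact: subset_closure].
Qed.

Lemma continuous_closed_near w t z (e : R) : continuous_closed omega T w ->
  0 <= t <= T -> closure omega z -> 0 < e ->
  \forall x \near z & s \near t, 0 <= s <= T -> closure omega x ->
    `|w t z - w s x| <= e.
Proof.
move=> /subspace_continuousP cw tT cz e0.
have tzI : (`[0, T] `*` closure omega)%classic (t, z) by split; rewrite /= ?in_itv.
have /cvgrPdist_le /(_ _ e0) := cw (t, z) tzI.
rewrite near_withinE => -[[A B] /= [nA nB] AB].
exists (B, A) => // -[x s] [/= Bx As] sT cx.
by apply: (AB (s, x)) => //; split; rewrite /= ?in_itv.
Qed.

Lemma continuous_closed_slice w t z : continuous_closed omega T w ->
  0 <= t <= T -> closure omega z -> w t x @[x --> within omega (nbhs z)] --> w t z.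
Proof.
move=> cw tT cz; apply/cvgrPdist_le => e e0.
have [[B A] /= [nB nA] BA] := continuous_closed_near cw tT cz e0.
rewrite near_withinE; apply: filterS nB => x Bx ox.
apply: (BA (x, t)) => //; last exact: subset_closure.
by split => //=; exact: nbhs_singleton nA.
Qed.

Lemma continuous_closed_continuous w t : continuous_closed omega T w ->
  0 <= t <= T -> continuous_on omega (w t).
Proof.
move=> cw tT x ox.
by have := continuous_closed_slice cw tT (subset_closure ox); rewrite within_open_nbhs.
Qed.

Lemma continuous_closed_bounded w t : continuous_closed omega T w ->
  0 <= t <= T -> bounded_on omega (w t).
Proof.
move=> cw tT; apply: bounded_on_closure => // z cz.
by eexists; exact: cvg_bounded_near (continuous_closed_slice cw tT cz).
Qed.

Lemma continuous_closed_integrable w t : continuous_closed omega T w ->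
  0 <= t <= T -> leb2.-integrable omega (EFin \o w t).
Proof.
move=> cw tT; apply: continuous_on_integrable => //.
  exact: continuous_closed_continuous.
exact: continuous_closed_bounded.
Qed.

(** The convergence is uniform in space, by compactness of the closure. *)
Lemma continuous_closed_int2 w : continuous_closed omega T w ->
  {within `[0, T], continuous (fun t => int2 omega (w t))}.
Proof.
move=> cw; apply/subspace_continuousP => t; rewrite /= in_itv /= => tT.
have mo := open_measurable2 oo.
apply/cvgrPdist_le => e e0; rewrite near_withinE.
(* the summand 1 avoids a division by a vanishing area *)
pose e' := e / (area omega + 1).
have a0 : 0 <= area omega by exact: fine_ge0.
have e'0 : 0 < e' by apply: divr_gt0 => //; lra.
have /compact_near_coveringP := compact_closure_bounded bo.
move=> /(_ _ (nbhs t) (fun s x => 0 <= s <= T -> closure omega x ->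
  `|w t x - w s x| <= e') _) cov.
have : \forall s \near t, closure omega `<=` (fun x => 0 <= s <= T ->
    closure omega x -> `|w t x - w s x| <= e').
  apply: cov => z cz.
  have e2 : 0 < e' / 2 by lra.
  have [[B A] /= [nB nA] BA] := continuous_closed_near cw tT cz e2.
  exists (B, A) => // -[x s] [/= Bx As] sT cx.
  have h1 := BA (x, s) (conj Bx As) sT cx.
  have h2 := BA (x, t) (conj Bx (nbhs_singleton nA)) tT cx.
  rewrite /= in h1 h2.
  have -> : w t x - w s x = (w t z - w s x) - (w t z - w t x) by ring.
  by apply: le_trans (ler_normB _ _) _; lra.
apply: filterS => s hs /= sT.
have it := continuous_closed_integrable cw tT.
have is_ := continuous_closed_integrable cw sT.
rewrite -[X in `|X|]RintegralB//.
apply: (@le_trans _ _ (e' * area omega)).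
  apply: norm_int2_le => //; first exact: leb2_bounded.
    by have := integrableB _ it is_; apply.
  by move=> x /subset_closure cx; exact: hs.
by rewrite /e' mulrAC ler_pdivrMr; nra.
Qed.

(** Differentiation under the integral, dominated by the constant bound of the time
    derivative on a small time interval. *)
Lemma C1t_int2 w t : continuous_closed omega T w -> C1t omega T w -> 0 < t < T ->
  derivable (fun s => int2 omega (w s)) t 1 /\
  derive1 (fun s => int2 omega (w s)) t = int2 omega (dt w t).
Proof.
move=> cw [dw cdw] tT; have mo := open_measurable2 oo.
have [e [M [e0 hM]]] := C0bar_locally_bounded cdw tT.
have Ie s : `](t - e), (t + e)[%classic s -> `|t - s| < e.
  by rewrite /= in_itv /= -ltr_distlC.
have It : `](t - e), (t + e)[%classic t.
  by rewrite /= in_itv /=; apply/andP; split; lra.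
(* an actual point is needed to know that the bound M is nonnegative *)
have [[x ox]|none] := pselect (exists x, omega x); last first.
  have Z f : int2 omega f = 0.
    rewrite (_ : omega = set0) /int2 ?Rintegral_set0//.
    by apply/seteqP; split => // x ox; apply: none; exists x.
  rewrite Z (_ : (fun s => int2 omega (w s)) = cst 0); last by apply/funext => s; rewrite Z.
  by split; [exact: derivable_cst|exact: derive1_cst].
have M0 : 0 <= M.
  by have [_] := hM t x (Ie t It) ox; apply: le_trans.
have sT s : `](t - e), (t + e)[%classic s -> 0 < s < T.
  by move=> /Ie ts; have [] := hM s x ts ox.
have H1 s : `](t - e), (t + e)[%classic s -> leb2.-integrable omega (EFin \o w s).
  move=> /sT /andP[s0 sT']; apply: continuous_closed_integrable => //.
  by rewrite (ltW s0) (ltW sT').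
have H2 s y : `](t - e), (t + e)[%classic s -> omega y -> derivable (w ^~ y) s 1.
  by move=> /sT s0T oy; exact: dw.
have H3 : leb2.-integrable omega (EFin \o cst M).
  apply: continuous_on_integrable => //; first by move=> y _; exact: cvg_cst.
  by exists `|M|.
have H4 s y : `](t - e), (t + e)[%classic s -> omega y ->
    `|partial1of2 w s y| <= cst M y.
  by move=> /Ie ts oy; have [] := hM s y ts oy.
split.
  exact: (@derivable_under_integral _ _ _ leb2 w omega mo t (t - e) (t + e) It H1 H2 (cst M) (fun _ => M0) H3 H4).
exact: (@differentiation_under_integral _ _ _ leb2 w omega mo t (t - e) (t + e) It H1 H2 (cst M) (fun _ => M0) H3 H4).
Qed.

End slices.

(** * The mass balance *)

Section mass.
Context {R : realType} (omega : set (R * R)) (T : R).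
Context (oo : open omega) (bo : bounded_set omega).
Implicit Types (w : @field R) (t : R) (x z : R * R) (i : 'I_2).

Lemma Ckx_C0bar k w : Ckx omega T k w -> C0bar omega T w.
Proof. by case: k => [|k] []. Qed.

Lemma Ckx_dx k w i : Ckx omega T k.+1 w -> Ckx omega T k (dx i w).
Proof. by move=> [_ /(_ i)[]]. Qed.

Lemma Ckx_Ck1 k w t : Ckx omega T k.+1 w -> 0 < t < T -> Ck_on omega 1 (w t).
Proof.
move=> cw tT; split=> [|i].
  exact: C0bar_continuous (Ckx_C0bar cw) tT.
have [_ /(_ i)[dw cdw]] := cw; split=> [x ox|]; first exact: dw.
by split=> //; exact: C0bar_continuous (Ckx_C0bar cdw) tT.
Qed.

Lemma bounded_onM (f g : R * R -> R) : bounded_on omega f -> bounded_on omega g ->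
  bounded_on omega (fun x => f x * g x).
Proof.
move=> [M hM] [N hN]; exists (M * N) => x ox.
by rewrite normrM; apply: ler_pM => //; [exact: hM|exact: hN].
Qed.

Lemma bounded_onB (f g : R * R -> R) : bounded_on omega f -> bounded_on omega g ->
  bounded_on omega (fun x => f x - g x).
Proof.
move=> [M hM] [N hN]; exists (M + N) => x ox.
by apply: le_trans (ler_normB _ _) _; apply: lerD; [exact: hM|exact: hN].
Qed.

Lemma bounded_onD (f g : R * R -> R) : bounded_on omega f -> bounded_on omega g ->
  bounded_on omega (fun x => f x + g x).
Proof.
move=> [M hM] [N hN]; exists (M + N) => x ox.
by apply: le_trans (ler_normD _ _) _; apply: lerD; [exact: hM|exact: hN].
Qed.

Lemma bounded_on_eq (f g : R * R -> R) : (forall x, omega x -> f x = g x) ->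
  bounded_on omega g -> bounded_on omega f.
Proof. by move=> fg [M hM]; exists M => x ox; rewrite fg// hM. Qed.

Definition mass_flux (P : @parameters R) (S : @state R) t : 'I_2 -> R * R -> R :=
  fun i x => phase S t x * vel S i t x - tau P * dx i (chem S) t x.

Lemma chart_normal z (U : set (R * R)) (r : R * R -> R) : C2_chart omega z U r ->
  outward_normal omega z
    (fun i => partial i r z / Num.sqrt (\sum_(j < 2) partial j r z ^+ 2)).
Proof. by move=> ch; exists U, r. Qed.

Lemma chart_grad_gt0 z (U : set (R * R)) (r : R * R -> R) : C2_chart omega z U r ->
  0 < Num.sqrt (\sum_(j < 2) partial j r z ^+ 2).
Proof.
move=> [_ _ _ [i ri] _]; rewrite sqrtr_gt0 (bigD1 i)//=.
apply: ltr_pwDl; first by rewrite exprn_even_gt0.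
by apply: sumr_ge0 => j _; exact: sqr_ge0.
Qed.

Let unnormalize (p q a b N : R) : N != 0 -> p / N * a + q / N * b = 0 ->
  a * p + b * q = 0.
Proof.
move=> N0 h; have -> : a * p + b * q = N * (p / N * a + q / N * b) by field.
by rewrite h mulr0.
Qed.

(** The convective part vanishes on the boundary because the velocity does, and the
    diffusive part has no normal component because the normal derivative of the
    chemical potential is zero. *)
Lemma mass_flux_tangential P S t : regular omega T S ->
  boundary_conditions omega T P S -> 0 < t < T -> tangential omega (mass_flux P S t).
Proof.
move=> [ru _ [cphi _ rphi] rmu _] bc tT.
have tT' : 0 <= t <= T by move: tT => /andP[/ltW -> /ltW ->].
have ck_phi : Ck_on omega 1 (phase S t) := Ckx_Ck1 rphi tT.
have ck_u i : Ck_on omega 1 (vel S i t) by have [_ _ ui] := ru i; exact: Ckx_Ck1 ui tT.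
have ck_mu i : Ck_on omega 1 (dx i (chem S) t).
  exact: Ckx_Ck1 (Ckx_dx i rmu) tT.
have ck_tau : Ck_on omega 1 (cst (tau P)) by exact: Ck1_cst.
have bd k w : Ckx omega T k w -> bounded_on omega (w t).
  by move=> /Ckx_C0bar cw; exact: C0bar_bounded cw tT.
have btau : bounded_on omega (cst (tau P)) by exists `|tau P|.
have bu i : bounded_on omega (vel S i t) by have [_ _ /bd] := ru i.
have bmu i : bounded_on omega (dx i (chem S) t) by exact: bd (Ckx_dx i rmu).
split=> [i|i|i|z U r bz ch].
- exact: (Ck1B oo (Ck1M oo ck_phi (ck_u i)) (Ck1M oo ck_tau (ck_mu i))).
- by apply: bounded_onB; apply: bounded_onM => //; exact: bd rphi.
- apply: (@bounded_on_eq _ (fun x => (dx i (phase S) t x * vel S i t x +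
     phase S t x * dx i (vel S i) t x) - tau P * dx i (dx i (chem S)) t x)).
    move=> x ox; rewrite (partialB i (Ck1M oo ck_phi (ck_u i)) (Ck1M oo ck_tau (ck_mu i)) ox).
    rewrite (partialM i ck_phi (ck_u i) ox) (partialM i ck_tau (ck_mu i) ox).
    by rewrite partial_cst mul0r add0r.
  apply: bounded_onB.
    apply: bounded_onD; apply: bounded_onM => //; [exact: bd (Ckx_dx i rphi)|exact: bd rphi|].
    by have [_ _ ui] := ru i; exact: bd (Ckx_dx i ui).
  by apply: bounded_onM => //; exact: bd (Ckx_dx i (Ckx_dx i rmu)).
- have [cz _] := bz.
  have [bcu _ bcmu _] := bc t z _ tT bz (chart_normal ch).
  pose m i := trace omega T (dx i (chem S)) t z.
  have cr := Ck1_of_chart ch; have [oU Uz _ _ _] := ch.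
  have lim_term i : (mass_flux P S t i x * partial i r x)
      @[x --> within omega (nbhs z)] --> - tau P * (m i * partial i r z).
    have -> : - tau P * (m i * partial i r z) =
      (phase S t z * vel S i t z - tau P * m i) * partial i r z.
      by rewrite bcu; ring.
    apply: cvgM; last first.
      by apply: cvg_within_filter; exact: (Ck1_partial cr Uz).
    apply: cvgB; apply: cvgM.
    + exact: continuous_closed_slice.
    + by have [cu _ _] := ru i; exact: continuous_closed_slice.
    + exact: cvg_cst.
    + exact: C0bar_slice (Ckx_C0bar (Ckx_dx i rmu)) tT cz.
  have -> : flux (mass_flux P S t) r = fun x =>
      mass_flux P S t ord0 x * partial ord0 r x +
      mass_flux P S t ord_max x * partial ord_max r x.
    by apply/funext => x; rewrite /flux sum2.
  have E : m ord0 * partial ord0 r z + m ord_max * partial ord_max r z = 0.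
    move: bcmu; rewrite /dn sum2; set N := Num.sqrt _.
    have N0 : N != 0 by rewrite gt_eqF//; exact: chart_grad_gt0 ch.
    exact: unnormalize.
  rewrite -[X in _ --> X](_ : - tau P * (m ord0 * partial ord0 r z) +
    - tau P * (m ord_max * partial ord_max r z) = 0); last by rewrite -mulrDr E mulr0.
  exact: cvgD.
Qed.

(** The middle term disappears when the velocity is solenoidal. *)
Lemma div2_mass_flux P S t x : regular omega T S -> 0 < t < T -> omega x ->
  div2 (mass_flux P S t) x = advect (vel S) (phase S) t x
    + phase S t x * divergence (vel S) t x - tau P * laplacian (chem S) t x.
Proof.
move=> [ru _ [_ _ rphi] rmu _] tT ox.
have ck_phi : Ck_on omega 1 (phase S t) := Ckx_Ck1 rphi tT.
have ck_u i : Ck_on omega 1 (vel S i t) by have [_ _ ui] := ru i; exact: Ckx_Ck1 ui tT.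
have ck_mu i : Ck_on omega 1 (dx i (chem S) t).
  exact: Ckx_Ck1 (Ckx_dx i rmu) tT.
have ck_tau : Ck_on omega 1 (cst (tau P)) by exact: Ck1_cst.
have E i : partial i (mass_flux P S t i) x = dx i (phase S) t x * vel S i t x +
     phase S t x * dx i (vel S i) t x - tau P * dx i (dx i (chem S)) t x.
  rewrite (partialB i (Ck1M oo ck_phi (ck_u i)) (Ck1M oo ck_tau (ck_mu i)) ox).
  rewrite (partialM i ck_phi (ck_u i) ox) (partialM i ck_tau (ck_mu i) ox).
  by rewrite partial_cst mul0r add0r.
rewrite /div2 sum2 E E /advect /divergence /laplacian.
rewrite (sum2 (fun j => vel S j t x * dx j (phase S) t x)).
rewrite (sum2 (fun j => dx j (vel S j) t x)) (sum2 (fun j => dx j (dx j (chem S)) t x)).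
generalize (dx ord0 (dx ord0 (chem S)) t x) (dx ord_max (dx ord_max (chem S)) t x)
  (dx ord0 (vel S ord0) t x) (dx ord_max (vel S ord_max) t x)
  (dx ord0 (phase S) t x) (dx ord_max (phase S) t x)
  (vel S ord0 t x) (vel S ord_max t x) (phase S t x) (tau P) => *; ring.
Qed.

(** The source equals the time derivative plus the divergence of the mass flux. *)
Lemma mass_balance P S gu gpsi gphi t : C2_boundary omega ->
  regular omega T S -> solves omega T P S gu gpsi gphi ->
  boundary_conditions omega T P S -> 0 < t < T ->
  derivable (fun s => int2 omega (phase S s)) t 1 /\
  derive1 (fun s => int2 omega (phase S s)) t = int2 omega (gphi t).
Proof.
move=> C2o rS sS bc tT.
have [_ _ [cphi dphi _] _ _] := rS.
have [der ->] := C1t_int2 oo bo cphi dphi tT; split => //.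
have tW := mass_flux_tangential rS bc tT.
have [iW _] := div2_integrable oo bo tW.
have mo := open_measurable2 oo.
have idt : leb2.-integrable omega (EFin \o dt (phase S) t).
  have [_ cdt] := dphi; apply: (continuous_on_integrable oo bo).
    exact: C0bar_continuous cdt tT.
  exact: C0bar_bounded cdt tT.
rewrite [RHS](@eq_int2 _ _ _ (fun x => dt (phase S) t x + div2 (mass_flux P S t) x)).
  rewrite [RHS]RintegralD// -!/(int2 _ _).
  by rewrite (divergence_tangential oo bo C2o tW) addr0.
move=> x ox; have [_ du _ ph _] := sS t x tT ox.
rewrite (div2_mass_flux P rS tT ox) /= du mulr0 addr0.
by rewrite addrA ph; ring.
Qed.

Lemma constant_of_derive0 (f : R -> R) t : {within `[0, T], continuous f} ->
  (forall s, 0 < s < T -> derivable f s 1 /\ derive1 f s = 0) ->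
  0 <= t <= T -> f t = f 0.
Proof.
move=> cf df /andP[t0 tT].
have h (s : R) : s \in `]0, t[ -> is_derive s 1 f 0.
  rewrite in_itv /= => /andP[s0 st].
  have [|ds d0] := df s; first by rewrite s0 (lt_le_trans st).
  by split=> //; rewrite -derive1E.
have ct : {within `[0, t], continuous f}.
  by apply: continuous_subspaceW cf; apply: subset_itvl; rewrite bnd_simp.
have [c _] := MVT_segment t0 h ct.
by rewrite mul0r => /eqP; rewrite subr_eq0 => /eqP.
Qed.

End mass.

(** * Classical derivatives are weak derivatives *)

Section weak.
Context {R : realType} (omega : set (R * R)).
Context (oo : open omega) (bo : bounded_set omega).
Implicit Types (w dw chi : R * R -> R) (x z : R * R) (i : 'I_2).

Lemma test_function_Ck1 chi : test_function omega chi -> Ck_on setT 1 chi.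
Proof. by case=> /(_ 1). Qed.

Lemma test_function_partial chi i : test_function omega chi ->
  test_function omega (partial i chi).
Proof.
move=> [Ck [K [cK Ko chi0]]]; split=> [k|].
  by have [_ /(_ i)[]] := Ck k.+1.
exists K; split=> // x Kx; apply: (@partial_zero _ (~` K)) => //.
by apply: closed_openC; apply: compact_closed => //; exact: norm_hausdorff.
Qed.

Definition C0b w := continuous_on omega w /\ bounded_on omega w.

Lemma C0b_integrable w : C0b w -> leb2.-integrable omega (EFin \o w).
Proof. by case=> *; exact: continuous_on_integrable. Qed.

Lemma C0bM w1 w2 : C0b w1 -> C0b w2 -> C0b (fun x => w1 x * w2 x).
Proof.
move=> [c1 b1] [c2 b2]; split; last exact: bounded_onM.
by move=> x ox; apply: cvgM; [exact: c1|exact: c2].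
Qed.

Lemma C0bB w1 w2 : C0b w1 -> C0b w2 -> C0b (fun x => w1 x - w2 x).
Proof.
move=> [c1 b1] [c2 b2]; split; last exact: bounded_onB.
by move=> x ox; apply: cvgB; [exact: c1|exact: c2].
Qed.

Lemma test_function_C0b chi : test_function omega chi -> C0b chi.
Proof.
move=> /test_function_Ck1 cchi; split.
  by apply: Ck1_continuous; apply: Ck1_sub cchi.
by have [] := bounded_on_C1 bo cchi.
Qed.

(** The product [w * chi] has compact support in [omega], so the integral of its
    derivative is zero. *)
Lemma integration_by_parts_test i w dw chi : C0b w -> C0b dw ->
  (forall x, omega x -> is_derive x (basis i) w (dw x)) -> test_function omega chi ->
  int2 omega (fun x => w x * partial i chi x) = - int2 omega (fun x => dw x * chi x).
Proof.
move=> bw bdw hw tchi.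
have bchi := test_function_C0b tchi.
have bpchi := test_function_C0b (test_function_partial i tchi).
have cchi := test_function_Ck1 tchi.
have [_ [K [cK Ko chi0]]] := tchi.
have hd x : omega x -> is_derive x (basis i) (fun y => w y * chi y)
    (dw x * chi x + w x * partial i chi x).
  by move=> ox; apply: is_derive_prod; [exact: hw|exact: Ck1_is_derive cchi _].
have E x : omega x -> partial i (fun y => w y * chi y) x =
    dw x * chi x + w x * partial i chi x by move=> /hd[].
have [|||_] := @int2_partial_compact_support _ _ _ (fun y => w y * chi y) i oo cK Ko.
- by move=> x /hd[].
- apply: (continuous_on_eq oo E) => x ox.
  by apply: cvgD; [have [c _] := C0bM bdw bchi; exact: c|have [c _] := C0bM bw bpchi; exact: c].
- by move=> x ox /chi0 ->; rewrite mulr0.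
rewrite (eq_int2 E) /int2 RintegralD//; first last.
- exact: C0b_integrable (C0bM bw bpchi).
- exact: C0b_integrable (C0bM bdw bchi).
- exact: open_measurable2.
by rewrite addrC => /eqP; rewrite addr_eq0 => /eqP.
Qed.

(** At most two integrations by parts; the outermost derivative of the test function
    is moved first, so that mixed derivatives never have to be exchanged. *)
Lemma weak_derivatives w (d : 'I_2 -> R * R -> R) (dd : 'I_2 -> 'I_2 -> R * R -> R) :
  (forall f, C0b f -> L2 omega f) ->
  C0b w -> (forall i, C0b (d i)) -> (forall i j, C0b (dd i j)) ->
  (forall i x, omega x -> is_derive x (basis i) w (d i x)) ->
  (forall i j x, omega x -> is_derive x (basis j) (d i) (dd i j x)) ->
  H2 omega w.
Proof.
move=> L2b bw bd bdd hd hdd; split; first exact: L2b.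
have P1 i chi : test_function omega chi ->
    int2 omega (fun x => w x * partial i chi x) = - int2 omega (fun x => d i x * chi x).
  by apply: integration_by_parts_test => // x ox; exact: hd.
have P2 i j chi : test_function omega chi ->
    int2 omega (fun x => w x * partial i (partial j chi) x) =
    int2 omega (fun x => dd i j x * chi x).
  move=> tchi; rewrite P1; last exact: test_function_partial.
  by rewrite (@integration_by_parts_test j _ (dd i j)) ?opprK// => x ox; exact: hdd.
case=> [|[|[|a]]] [|[|[|b]]] // _.
- exists w; split; [exact: L2b|move=> chi _; by rewrite expr0 mul1r].
- exists (d ord_max); split; [exact: L2b|move=> chi tchi].
  by rewrite expr1 mulN1r /= P1.
- exists (dd ord_max ord_max); split; [exact: L2b|move=> chi tchi].
  by rewrite sqrrN expr1n mul1r /= P2.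
- exists (d ord0); split; [exact: L2b|move=> chi tchi].
  by rewrite expr1 mulN1r /= P1.
- exists (dd ord0 ord_max); split; [exact: L2b|move=> chi tchi].
  by rewrite sqrrN expr1n mul1r /= P2.
- exists (dd ord0 ord0); split; [exact: L2b|move=> chi tchi].
  by rewrite sqrrN expr1n mul1r /= P2.
Qed.

End weak.

(** * Square-integrable functions *)

Section L2.
Context {R : realType} (omega : set (R * R)).
Context (oo : open omega) (bo : bounded_set omega).
Implicit Types (w f : R * R -> R) (x z : R * R) (i : 'I_2).

Let mo : measurable omega := open_measurable2 oo.

Local Notation N2 f := (Lnorm leb2 2%:E (EFin \o (f \_ omega))).

Lemma Lnorm2E f : N2 f = ((\int[leb2]_(x in omega) (f x ^+ 2)%:E) `^ 2^-1)%E.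
Proof.
rewrite unlock; congr (_ `^ _)%E; rewrite [in RHS]integral_mkcond.
apply: eq_integral => x _; rewrite !patchE /= patchE.
case: ifPn => _; last by rewrite normr0 powR0.
by rewrite powR_mulrn// real_normK ?num_real.
Qed.

Lemma C0b_L2 f : C0b omega f -> L2 omega f.
Proof.
move=> bf; split; first by case: bf => cf _; exact: continuous_on_measurable.
rewrite Lnorm2E; apply: poweR_lty.
have := C0b_integrable oo bo (C0bM bf bf) => /integrableP[_].
apply: le_lt_trans; rewrite le_eqVlt; apply/orP; left; apply/eqP.
by apply: eq_integral => x _; rewrite /= -expr2 ger0_norm ?sqr_ge0.
Qed.

Lemma L2_measurableT f : L2 omega f -> measurable_fun setT (f \_ omega).
Proof. by case=> mf _; apply/(measurable_restrictT _ _).1. Qed.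

Lemma L2B f g : L2 omega f -> L2 omega g -> L2 omega (fun x => f x - g x).
Proof.
move=> Lf Lg; have [mf Nf] := Lf; have [mg Ng] := Lg.
split; first exact: measurable_funB.
have -> : (fun x => f x - g x) \_ omega = ((f \_ omega) \+ (\- (g \_ omega)))%R.
  by apply/funext => x; rewrite /= !patchE; case: ifP => _; rewrite ?subr0.
apply: le_lt_trans (minkowski_EFin _ _ _ _) _.
- exact: L2_measurableT.
- exact: measurableT_comp (L2_measurableT Lg).
- by rewrite ler1n.
apply: lte_add_pinfty => //.
have -> : EFin \o (\- (g \_ omega))%R = (\- (EFin \o g \_ omega))%E by [].
by rewrite oppe_Lnorm.
Qed.

Let one : R * R -> R := cst 1.

Lemma Lnorm2_cst1 : N2 one = (Num.sqrt (area omega))%:E.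
Proof.
rewrite Lnorm2E; under eq_integral do rewrite /= expr1n.
rewrite integral_cst// mul1e -[X in (X `^ _)%E]fineK.
  by rewrite poweR_EFin powR12_sqrt// fine_ge0.
by rewrite ge0_fin_numE//; exact: leb2_bounded.
Qed.

(** Hoelder's inequality against the indicator of [omega]. *)
Lemma L2_hoelder f : L2 omega f ->
  (\int[leb2]_(x in omega) `|f x|%:E <= (L2norm omega f * Num.sqrt (area omega))%:E)%E.
Proof.
move=> Lf; have [mf Nf] := Lf.
have m1 : measurable_fun setT (one \_ omega).
  by apply/(measurable_restrictT _ _).1 => //; exact: measurable_cst.
have h2 : (0 < 2 :> R) by [].
have h22 : (2^-1 + 2^-1 = 1 :> R) by lra.
have := @hoelder _ _ _ leb2 (f \_ omega) (one \_ omega) 2 2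
  (L2_measurableT Lf) m1 h2 h2 h22.
rewrite Lnorm2_cst1 Lnorm1 EFinM /L2norm fineK; last first.
  by rewrite ge0_fin_numE ?Lnorm_ge0.
apply: le_trans; rewrite le_eqVlt; apply/orP; left; apply/eqP.
rewrite [LHS]integral_mkcond.
apply: eq_integral => x _; rewrite /= !patchE; case: ifP => _; last by rewrite mul0r normr0.
by rewrite mulr1.
Qed.

Lemma L2_integrable f : L2 omega f -> leb2.-integrable omega (EFin \o f).
Proof.
move=> Lf; have [mf _] := Lf; apply/integrableP; split; first exact/measurable_EFinP.
by apply: le_lt_trans (L2_hoelder Lf) _; rewrite ltry.
Qed.

Lemma norm_int2_L2 f : L2 omega f ->
  `|int2 omega f| <= L2norm omega f * Num.sqrt (area omega).
Proof.
move=> Lf; have iff := L2_integrable Lf.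
rewrite -lee_fin EFin_normr_Rintegral//; apply: le_trans (L2_hoelder Lf).
by have [mf _] := integrableP _ _ _ iff; apply: le_abse_integral.
Qed.

End L2.

Lemma H2_of_smooth_pair (R : realType) (omega : set (R * R)) (T : R)
    (w1 w2 : @field R) (t : R) : open omega -> bounded_set omega ->
  Ckx omega T 2 w1 -> Ckx omega T 2 w2 -> 0 < t < T ->
  H2 omega (fun x => w1 t x - w2 t x).
Proof.
move=> oo bo c1 c2 tT.
have b w k : Ckx omega T k w -> C0b omega (w t).
  by move=> /Ckx_C0bar cw; split; [exact: C0bar_continuous cw tT|exact: C0bar_bounded cw tT].
apply: (@weak_derivatives _ _ oo bo _ (fun i x => dx i w1 t x - dx i w2 t x)
  (fun i j x => dx j (dx i w1) t x - dx j (dx i w2) t x)).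
- by move=> f; exact: C0b_L2.
- by apply: C0bB; apply: b; [exact: c1|exact: c2].
- by move=> i; apply: C0bB; apply: b; [exact: Ckx_dx c1|exact: Ckx_dx c2].
- by move=> i j; apply: C0bB; apply: b; [exact/Ckx_dx/Ckx_dx/c1|exact/Ckx_dx/Ckx_dx/c2].
- move=> i x ox; apply: is_deriveB.
    exact: Ck1_is_derive (Ckx_Ck1 oo c1 tT) ox.
  exact: Ck1_is_derive (Ckx_Ck1 oo c2 tT) ox.
- move=> i j x ox; apply: is_deriveB.
    exact: Ck1_is_derive (Ckx_Ck1 oo (Ckx_dx i c1) tT) ox.
  exact: Ck1_is_derive (Ckx_Ck1 oo (Ckx_dx i c2) tT) ox.
Qed.

(** * Conservation of mass and the evolution of the mean error *)

Theorem theorem2p2 (R : realType) (omega : set (R * R)) (T : R)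
  (P : parameters) (alpha_u alpha_phi alpha_psi : R)
  (adm : set R)
  (eta_min eta_max nu_min nu_max kap_min kap_max : R)
  (q C c_F C_F : R)
  (IH : (R * R -> R) -> (R * R -> R)) (h c0 : R)
  (S A : state)
  (u0 v0 psi0 zeta0 : 'I_2 -> R * R -> R) (phi0 vphi0 : R * R -> R) :
  C2_simply_connected_domain omega ->
  0 < T ->
  [/\ 0 < rho P, 0 < Rey P & 0 < lam P] ->
  [/\ 0 < gam P, 0 < tau P & 0 < eps P] ->
  [/\ 0 <= alpha_u, 0 <= alpha_phi & 0 <= alpha_psi] ->
  (* coefficients, with bounds on the set adm of admissible phase values *)
  [/\ coefficient (eta P), coefficient (nu P) & coefficient (kap P)] ->
  [/\ 0 < eta_min, 0 <= nu_min & 0 < kap_min] ->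
  (forall s, adm s ->
    [/\ eta_min <= eta P s <= eta_max, nu_min <= nu P s <= nu_max &
        kap_min <= kap P s <= kap_max]) ->
  (forall t x, 0 < t < T -> omega x -> adm (phase S t x) /\ adm (phase A t x)) ->
  (* potential *)
  C2 (pot P) -> double_well (pot P) ->
  3 <= q -> 0 < C -> 0 < c_F -> 0 <= C_F ->
  (forall s, `|derive1 (pot P) s| <= C * (1 + `|s| `^ (q - 1))) ->
  (forall s, pot P s >= c_F * `|s| `^ q - C_F) ->
  (* observation operator *)
  observation_operator omega IH ->
  0 < h -> 0 < c0 ->
  (forall w, H2 omega w ->
    L2norm omega (fun x => w x - IH w x) ^+ 2
    <= 4^-1 * c0 ^+ 2 * h ^+ 4 * H2norm omega w ^+ 2) ->
  (* solutions *)
  reference_solution omega T P S u0 phi0 psi0 ->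
  assimilated_solution omega T P alpha_u alpha_phi alpha_psi IH S A
    v0 vphi0 zeta0 ->
  let phi := phase S in
  let vphi := phase A in
  let e := fun t x => phi t x - vphi t x in
  [/\ forall t, 0 <= t <= T -> int2 omega (phi t) = int2 omega phi0,
      forall t, 0 < t < T ->
        derivable (fun s => int2 omega (vphi s)) t 1 /\
        derive1 (fun s => int2 omega (vphi s)) t
        = alpha_phi * int2 omega (IH (fun x => phi t x - vphi t x)),
      forall t, 0 < t < T ->
        derivable (fun s => int2 omega (e s)) t 1 /\
        derive1 (fun s => int2 omega (e s)) t + alpha_phi * int2 omega (e t)
        = alpha_phi * int2 omega (fun x => e t x - IH (e t) x) &
      forall t, 0 < t < T ->
        derivable (fun s => mean omega (phi s) - mean omega (vphi s)) t 1 /\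
        `|derive1 (fun s => mean omega (phi s) - mean omega (vphi s)) t
          + alpha_phi * (mean omega (phi t) - mean omega (vphi t))|
        <= c0 / 2 * alpha_phi * (Num.sqrt (area omega))^-1 * h ^+ 2
           * H2norm omega (e t)].
Proof.
move=> [oo one _ bo [_ C2o]] T0 _ [_ tau0 _] [_ a0 _] _ _ _ _ _ _ _ _ _ _ _ _
  [IHL2 _] h0 c00 IHest refS assA phi vphi e.
have [rS sS bS iS] := refS; have [rA sA bA iA] := assA.
have [_ _ [cphi dphi kphi] _ _] := rS; have [_ _ [cvphi dvphi kvphi] _ _] := rA.
have mo := open_measurable2 oo.
have tT' t : 0 < t < T -> 0 <= t <= T by move=> /andP[/ltW -> /ltW ->].
have mS t : 0 < t < T -> derivable (fun s => int2 omega (phi s)) t 1 /\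
    derive1 (fun s => int2 omega (phi s)) t = 0.
  move=> tT; have [der ->] := mass_balance oo bo C2o rS sS bS tT.
  by split => //; rewrite /int2 Rintegral_cst// mul0r.
have H2e t : 0 < t < T -> H2 omega (e t).
  by move=> tT; exact: H2_of_smooth_pair kphi kvphi tT.
have mA t : 0 < t < T -> derivable (fun s => int2 omega (vphi s)) t 1 /\
    derive1 (fun s => int2 omega (vphi s)) t = alpha_phi * int2 omega (IH (e t)).
  move=> tT; have [der ->] := mass_balance oo bo C2o rA sA bA tT.
  split=> //; rewrite /int2 RintegralZl//.
  exact: L2_integrable (IHL2 _ (H2e t tT)).
have intE s : 0 <= s <= T ->
    int2 omega (e s) = int2 omega (phi s) - int2 omega (vphi s).
  by move=> sT; rewrite /int2 RintegralB//; exact: continuous_closed_integrable sT.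
have Le t : 0 < t < T -> L2 omega (e t) by move=> /H2e[].
have intIe t : 0 < t < T -> int2 omega (fun x => e t x - IH (e t) x) =
    int2 omega (e t) - int2 omega (IH (e t)).
  by move=> tT; rewrite /int2 RintegralB//; apply: L2_integrable => //; [exact: Le|exact/IHL2/H2e].
have dE t : 0 < t < T ->
  derivable (fun s => int2 omega (phi s) - int2 omega (vphi s)) t 1 /\
  derive1 (fun s => int2 omega (phi s) - int2 omega (vphi s)) t =
    - (alpha_phi * int2 omega (IH (e t))).
  move=> tT; have [d1 e1] := mS t tT; have [d2 e2] := mA t tT.
  split; first exact: derivableB.
  by rewrite derive1E (deriveB d1 d2) -derive1E e1 -derive1E e2 sub0r.
split.
- move=> t tT.
  rewrite (constant_of_derive0 (continuous_closed_int2 oo bo cphi) mS tT).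
  by apply: eq_int2 => x ox; have [] := iS x ox.
- exact: mA.
- move=> t tT; have [d1 e1] := dE t tT.
  have n : \forall s \near t, int2 omega (phi s) - int2 omega (vphi s) = int2 omega (e s).
    have : nbhs t `]0, T[%classic.
      by apply: open_nbhs_nbhs; split; [exact: interval_open|rewrite /= in_itv].
    by apply: filterS => s; rewrite /= in_itv /= => /tT' sT; rewrite intE.
  split; first exact: near_eq_derivable n d1.
  rewrite derive1E -(near_eq_derive _ n) -derive1E e1 intIe//; ring.
- move=> t tT; have [d1 e1] := dE t tT.
  pose k := (area omega)^-1.
  have mE : (fun s => mean omega (phi s) - mean omega (vphi s)) =
      (fun s => k * (int2 omega (phi s) - int2 omega (vphi s))).
    by apply/funext => s; rewrite /mean mulrBr.
  rewrite mE; split; first exact: (derivableM (derivable_cst _ _ _) d1).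
  rewrite derive1Ml// e1 /mean -mulrBr -intE ?tT'//.
  have -> : k * - (alpha_phi * int2 omega (IH (e t))) + alpha_phi * (k * int2 omega (e t)) =
      alpha_phi * (k * int2 omega (fun x => e t x - IH (e t) x)).
    by rewrite intIe//; ring.
  have Lei : L2 omega (fun x => e t x - IH (e t) x).
    by apply: L2B => //; [exact: Le|exact/IHL2/H2e].
  have k0 : 0 <= k by rewrite invr_ge0 fine_ge0.
  have est : L2norm omega (fun x => e t x - IH (e t) x) <=
      c0 / 2 * h ^+ 2 * H2norm omega (e t).
    have Hn : 0 <= H2norm omega (e t) by exact: sqrtr_ge0.
    rewrite -(@ler_pXn2r _ 2) ?nnegrE ?fine_ge0 ?Lnorm_ge0//; last first.
      by rewrite !mulr_ge0 ?exprn_ge0// ltW.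
    apply: le_trans (IHest _ (H2e t tT)) _.
    rewrite le_eqVlt; apply/orP; left; apply/eqP; by field.
  have aE : area omega = Num.sqrt (area omega) ^+ 2 by rewrite sqr_sqrtr// fine_ge0.
  have kr : k * Num.sqrt (area omega) = (Num.sqrt (area omega))^-1.
    rewrite /k [in X in X * _]aE expr2 invfM.
    (* with the convention 0^-1 = 0 the identity survives a vanishing area *)
    have [->|r0] := eqVneq (Num.sqrt (area omega)) 0; first by rewrite mulr0 invr0.
    by rewrite -mulrA mulVf ?mulr1.
  rewrite normrM (ger0_norm a0) normrM (ger0_norm k0).
  apply: (@le_trans _ _ (alpha_phi * (k * (c0 / 2 * h ^+ 2 * H2norm omega (e t) *
      Num.sqrt (area omega))))).
    apply: ler_wpM2l => //; apply: ler_wpM2l => //.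
    apply: le_trans (norm_int2_L2 oo bo Lei) _.
    by apply: ler_wpM2r => //; exact: sqrtr_ge0.
  by rewrite -kr le_eqVlt; apply/orP; left; apply/eqP; ring.
Qed.
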